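(* Let $\mu_L\in ID(\mathbb{R})$ with $\mu_L\neq\delta_0$. Then $\Lambda_{\mu_L}:ID(\mathbb{R}^+)\to ID(\mathbb{R})$ is injective, continuous (for weak convergence), and satisfies $\Lambda_{\mu_L}(\mu^1*\mu^2)=\Lambda_{\mu_L}(\mu^1)*\Lambda_{\mu_L}(\mu^2)$ for all $\mu^1,\mu^2\in ID(\mathbb{R}^+)$; i.e. it is a continuous injective homomorphism of convolution semigroups onto its image. Moreover, $\Lambda_{\mu_L}(ID(\mathbb{R}^+))\subsetneq ID(\mathbb{R})$.
   Context: $ID(\mathbb{R})$: infinitely divisible laws on $\mathbb{R}$; $ID(\mathbb{R}^+)$: those supported on $[0,\infty)$; $*$ is convolution. Let $\mu_L$ have characteristic triplet $(\gamma,b,\nu)$ w.r.t. truncation $x\mathbf 1_{\{|x|\le1\}}$, and $\mu_L^s$ the law with characteristic function $\hat\mu_L^{\,s}$. For $\mu_T\in ID(\mathbb{R}^+)$ with drift $\beta_0\ge0$ and Lévy measure $\rho$ on $(0,\infty)$, $\Lambda_{\mu_L}(\mu_T)$ is the infinitely divisible law with triplet $\bar b=b\beta_0$, $\bar\gamma=\gamma\beta_0+\int_0^\infty\int_{|x|\le1}x\,\mu_L^s(dx)\rho(ds)$, $\bar\nu(dx)=\beta_0\nu(dx)+\int_0^\infty\mu_L^s(dx)\rho(ds)$ on $\mathbb{R}\setminus\{0\}$; equivalently the law of $L_{T_1}$ for a Lévy process $L$ with $L_1\sim\mu_L$ and an independent subordinator $T$ with $T_1\sim\mu_T$. *)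

(* Defs.v *)
From HB Require Import structures.
From mathcomp Require Import all_boot all_order all_algebra.
From mathcomp Require Import all_classical all_reals all_analysis.
Set Implicit Arguments. Unset Strict Implicit. Unset Printing Implicit Defensive.
Import Order.TTheory GRing.Theory Num.Theory.
Import numFieldNormedType.Exports.
Local Open Scope classical_set_scope.
Local Open Scope ring_scope.

Section Defs.
Variable R : realType.
Local Open Scope ereal_scope.

Definition meq (P Q : set R -> \bar R) : Prop :=
  forall A, measurable A -> P A = Q A.

Definition convol (P Q : set R -> \bar R) : set R -> \bar R :=
  fun A => \int[P]_x Q [set y | A (x + y)%R].

Fixpoint nconv (Q : set R -> \bar R) (n : nat) : set R -> \bar R :=
  match n with
  | O => @dirac _ R 0%R R
  | S m => convol Q (nconv Q m)
  end.

Definition is_ID (P : probability R R) : Prop :=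
  forall n : nat, (0 < n)%N ->
    exists Q : probability R R, meq P (nconv Q n).

Definition is_IDplus (P : probability R R) : Prop :=
  is_ID P /\ P [set x | (0 <= x)%R] = 1.

Definition weak_cvg (Pn : nat -> probability R R) (P : probability R R) : Prop :=
  forall f : R -> R, continuous f -> (exists M : R, forall x, (`|f x| <= M)%R) ->
    (fun n => \int[Pn n]_x (f x)%:E) @ \oo --> \int[P]_x (f x)%:E.

(* (mus s)_{s >= 0} is the convolution semigroup generated by muL, i.e. the
   family of one-dimensional marginal laws of the Levy process L with
   L_1 ~ muL: mus s is the law with characteristic function hat(muL)^s. *)
Definition levy_semigroup (muL : probability R R) (mus : R -> probability R R) : Prop :=
  [/\ meq (mus 0%R) (@dirac _ R 0%R R),
      meq (mus 1%R) muL,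
      (forall s t : R, (0 <= s)%R -> (0 <= t)%R ->
          meq (mus (s + t)%R) (convol (mus s) (mus t))) &
      (forall (s : R) (sn : nat -> R), (0 <= s)%R -> (forall n, 0 <= sn n)%R ->
          sn @ \oo --> s -> weak_cvg (fun n => mus (sn n)) (mus s))].

(* nu = Lambda_{muL}(muT): nu is the law of L_{T_1}, T independent of L,
   i.e. nu(A) = \int muT(ds) mu_L^s(A). *)
Definition is_Lambda (mus : R -> probability R R) (muT nu : probability R R) : Prop :=
  meq nu (fun A => \int[muT]_s (mus s A)).

End Defs.

(* Main.v *)
(* Write z_s(u) for the characteristic function of [mus s] at u. For u near 0 the principal
logarithm gives z_s(u) = exp (- s (a(u) - i b(u))) with a, b continuous and a >= 0, and the
characteristic function of Lambda(mu) at u is the Laplace transform of mu at a(u) - i b(u).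

If a vanishes near 0, then [mus s] is the Dirac mass at s g for some g <> 0 and Lambda(mu) is
the image of mu under multiplication by g. Otherwise the Laplace transforms of two laws with
the same image agree on a nondegenerate curve in the open right half-plane. At the points
where a reaches a new maximum, which accumulate at each of them, all derivatives agree as well
(difference quotients along the curve). Expanding exp, cos and sin in power series carries the
equality to all large real arguments, and (1 - t^n)^(n k^n) with t = exp (- c s) converges to
the indicator of s > ln k / c, so the two laws coincide.

The image omits the Dirac mass at 1 or the one at -1: if both belonged to it, both would be
laws of the semigroup, and so would their convolution, the Dirac mass at 0, at a positive
time, which forces muL to be the Dirac mass at 0. *)
Require Import Defs.
From HB Require Import structures.
From mathcomp Require Import all_boot all_order all_algebra.
From mathcomp Require Import all_classical all_reals all_analysis.
From mathcomp Require Import measurable_realfun giry ring lra.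
Set Implicit Arguments. Unset Strict Implicit. Unset Printing Implicit Defensive.
Import Order.TTheory GRing.Theory Num.Theory.
Import numFieldNormedType.Exports.
Local Open Scope classical_set_scope.
Local Open Scope ring_scope.

(** * Expectations of bounded measurable functions *)

Section Expectation.
Variable R : realType.
Implicit Types (f g : R -> R) (m : subprobability R R).

(** The curve a - i b is only continuous and may fold back on itself, so nothing can be
    differentiated along a parameter. Laplace transforms are holomorphic, however, and their
    difference quotients along any sequence of distinct points tending to w converge to the
    derivative at w. Iterating this needs limit points that are themselves limits of points of the
    same kind. Records of a have this property, and their strictness keeps the points distinct. No
    complex numbers appear: a complex identity is stated as a family of real ones indexed by a
    phase.

    Analytic continuation takes place under the integral. A test function carrying exp (- a s) may
    absorb a series bounded by exp (a s / 2), so one step moves w by at most half its real part.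
    This is why the path first runs to the right, where the real part is large, and only then
    vertically to the real axis.

    Nothing is known of [mus s] for negative [s]: the family is frozen there, and integrals are
    compared on the half-line that carries the mass. *)

Definition bmeas f := measurable_fun setT f /\ exists M, forall x, `|f x| <= M.

Definition expect (m : set R -> \bar R) f : R := fine (\int[m]_x (f x)%:E).

Lemma bmeas_cst (c : R) : bmeas (cst c).
Proof. by split; [exact: measurable_cst | exists `|c| => x]. Qed.

Lemma bmeasD f g : bmeas f -> bmeas g -> bmeas (fun x => f x + g x).
Proof.
move=> [mf [M hM]] [mg [N hN]]; split; first exact: measurable_funD.
by exists (M + N) => x; apply: le_trans (ler_normD _ _) _; exact: lerD.
Qed.

Lemma bmeasM f g : bmeas f -> bmeas g -> bmeas (fun x => f x * g x).
Proof.
move=> [mf [M hM]] [mg [N hN]]; split; first exact: measurable_funM.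
by exists (M * N) => x; rewrite normrM ler_pM.
Qed.

Lemma bmeasZ (c : R) f : bmeas f -> bmeas (fun x => c * f x).
Proof. exact/bmeasM/bmeas_cst. Qed.

Lemma bmeasN f : bmeas f -> bmeas (fun x => - f x).
Proof.
by move=> hf; under eq_fun do rewrite -mulN1r; exact: bmeasZ.
Qed.

Lemma bmeasB f g : bmeas f -> bmeas g -> bmeas (fun x => f x - g x).
Proof. by move=> hf hg; apply: bmeasD => //; exact: bmeasN. Qed.

Lemma bmeas_comp f (h : R -> R) : measurable_fun setT h -> bmeas f ->
  bmeas (fun x => f (h x)).
Proof.
move=> mh [mf [M hM]]; split; first exact: measurableT_comp.
by exists M => x.
Qed.

Lemma bmeas_cont f : continuous f -> (exists M, forall x, `|f x| <= M) ->
  bmeas f.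
Proof. by move=> cf; split=> //; exact: continuous_measurable_fun. Qed.

Lemma bmeas_indic (A : set R) : measurable A -> bmeas (\1_A : R -> R).
Proof.
move=> mA; split; first exact: measurable_indic.
by exists 1 => x; rewrite indicE; case: (_ \in _); rewrite ?normr0 ?normr1.
Qed.

Lemma bmeas_sum (F : nat -> R -> R) n : (forall i, bmeas (F i)) ->
  bmeas (fun x => \sum_(i < n) F i x).
Proof.
move=> hF; elim: n => [|n IH].
  by under eq_fun do rewrite big_ord0; exact: bmeas_cst.
by under eq_fun do rewrite big_ord_recr/=; exact: bmeasD.
Qed.

Lemma bmeas_integrable m f : bmeas f -> m.-integrable setT (EFin \o f).
Proof.
move=> [mf [M hM]]; apply: measurable_bounded_integrable => //.
- by rewrite (le_lt_trans (@sprobability_setT _ _ _ m))// ltry.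
- by exists M; split; [exact: num_real|move=> y /ltW My x _; exact: le_trans My].
Qed.

Lemma expectE m f : bmeas f -> (\int[m]_x (f x)%:E)%E = (expect m f)%:E.
Proof.
move=> hf; rewrite /expect fineK//; apply: integrable_fin_num => //.
exact: bmeas_integrable.
Qed.

Lemma expectD m f g : bmeas f -> bmeas g ->
  expect m (fun x => f x + g x) = expect m f + expect m g.
Proof. by move=> hf hg; apply: RintegralD => //; exact: bmeas_integrable. Qed.

Lemma expectB m f g : bmeas f -> bmeas g ->
  expect m (fun x => f x - g x) = expect m f - expect m g.
Proof. by move=> hf hg; apply: RintegralB => //; exact: bmeas_integrable. Qed.

Lemma expectZ m (c : R) f : bmeas f ->
  expect m (fun x => c * f x) = c * expect m f.
Proof. by move=> hf; apply: RintegralZl => //; exact: bmeas_integrable. Qed.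

Lemma expect_sum m (F : nat -> R -> R) n : (forall i, bmeas (F i)) ->
  expect m (fun x => \sum_(i < n) F i x) = \sum_(i < n) expect m (F i).
Proof.
move=> hF; elim: n => [|n IH].
  rewrite big_ord0 /expect; under eq_integral do rewrite big_ord0.
  by rewrite integral0.
rewrite big_ord_recr /= -IH -expectD//; last exact: bmeas_sum.
by congr expect; apply/funext => x; rewrite big_ord_recr.
Qed.

Lemma le_expect m f g : bmeas f -> bmeas g -> (forall x, f x <= g x) ->
  expect m f <= expect m g.
Proof. by move=> hf hg fg; apply: le_Rintegral => //; exact: bmeas_integrable. Qed.

Lemma expect_indic m A : measurable A -> (expect m (\1_A))%:E = m A.
Proof.
by move=> mA; rewrite -expectE ?integral_indic ?setIT//; exact: bmeas_indic.
Qed.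

Lemma expect_cst (P : probability R R) (c : R) : expect P (cst c) = c.
Proof.
rewrite /expect/= integral_cst//=.
have -> : P setT = 1%E by exact: probability_setT.
by rewrite mule1.
Qed.

Lemma expect_cvg m (F : nat -> R -> R) f M :
  (forall n, bmeas (F n)) -> (forall n x, `|F n x| <= M) ->
  (forall x, F n x @[n --> \oo] --> f x) ->
  bmeas f /\ expect m (F n) @[n --> \oo] --> expect m f.
Proof.
move=> hF FM Ff.
have mf : measurable_fun setT f.
  by apply: (measurable_fun_cvg (h := F)) => // n; case: (hF n).
have fM x : `|f x| <= M.
  have h : `|F n x| @[n --> \oo] --> `|f x| by apply: cvg_norm; exact: Ff.
  rewrite -(cvg_lim _ h)//; apply: limr_le; last exact: nearW.
  by apply/cvg_ex; eexists; exact: h.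
have bf : bmeas f by split => //; exists M.
split => //.
have [] := @dominated_convergence _ _ _ m setT measurableT
   (fun n x => (F n x)%:E) (fun x => (f x)%:E) (fun=> M%:E).
- by move=> n; apply/measurable_EFinP; case: (hF n).
- exact/measurable_EFinP.
- by apply: aeW => x _; apply: cvg_EFin; [exact: nearW | exact: Ff].
- exact: (bmeas_integrable m (bmeas_cst M)).
- by apply: aeW => x n _; rewrite lee_fin.
- by move=> _ _ /=; rewrite expectE// => /fine_cvgP[].
Qed.

Lemma meq_expect (m1 m2 : {measure set R -> \bar R}) f : meq m1 m2 ->
  expect m1 f = expect m2 f.
Proof.
move=> h; rewrite /expect; congr fine; apply: eq_measure_integral => A mA _.
exact: h.
Qed.

Lemma expect_dirac (x : R) f : bmeas f -> expect (\d_x)%R f = f x.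
Proof.
move=> [mf _]; rewrite /expect integral_dirac//; last exact/measurable_EFinP.
by rewrite diracT mul1e.
Qed.

Lemma weak_cvgP (Pn : nat -> probability R R) (P : probability R R) :
  weak_cvg Pn P <-> (forall f, continuous f -> (exists M, forall x, `|f x| <= M) ->
    expect (Pn n) f @[n --> \oo] --> expect P f).
Proof.
split=> h f cf bf; have hf := bmeas_cont cf bf.
  by have := h f cf bf; rewrite expectE// => /fine_cvgP[].
rewrite expectE//; apply/fine_cvgP; split.
  by apply: nearW => n; rewrite expectE.
exact: (h f cf bf).
Qed.

End Expectation.

(** * Mixtures of kernels, convolution, and Fubini *)

Section Mixture.
Variable R : realType.
Implicit Types (P Q mu nu : probability R R) (A : set R).
Import HBNNSimple.

(* No measurability is assumed: [mus s] is unconstrained for [s < 0]. *)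
Lemma eq_integral_full_measure P (D : set R) (f g : R -> \bar R) :
  measurable D -> P D = 1%E -> (forall x, (0 <= f x)%E) ->
  (forall x, (0 <= g x)%E) -> (forall x, D x -> f x = g x) ->
  (\int[P]_x f x = \int[P]_x g x)%E.
Proof.
move=> mD PD; suff le (f' g' : R -> \bar R) : (forall x, (0 <= f' x)%E) ->
    (forall x, (0 <= g' x)%E) -> (forall x, D x -> f' x = g' x) ->
    (\int[P]_x f' x <= \int[P]_x g' x)%E.
  move=> f0 g0 fg; apply/eqP; rewrite eq_le !le// => x Dx.
  by rewrite fg.
move=> f0 g0 fg; rewrite !ge0_integralTE//.
apply: ge_ereal_sup => _ [h hf] <-.
(* The integral of a nonnegative function is a supremum over the simple functions below it. Cutting
   [h] off outside [D] keeps it below [g'] everywhere and alters it only on a null set. *)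
pose h' : {nnsfun R >-> R} := mul_nnsfun h (indic_nnsfun R mD).
have h'E x : h' x = h x * \1_D x by [].
apply: le_ereal_sup_tmp; exists (sintegral P h').
  exists h' => // x; rewrite h'E indicE; have [/set_mem Dx|_] := boolP (x \in D).
    by rewrite mulr1 -fg.
  by rewrite mulr0.
have PnD : P (~` D) = 0%E by rewrite probability_setC// PD subee.
rewrite -!integralT_nnsfun.
rewrite (@ae_eq_integral _ _ _ _ _ (fun x => (h' x)%:E))//.
- exact/measurable_EFinP.
- exact/measurable_EFinP.
- exists (~` D); split => //; first exact: measurableC.
  by move=> x nh Dx; apply: nh => _; rewrite h'E indicE mem_set// mulr1.
Qed.

(** The family retyped as a map into the Giry space, where measurability of a kernel makes sense. *)
Definition kern (M : R -> probability R R) (s : R) : giry R R := M s.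

(** Open half-lines form a pi-system generating the Borel sets, and the indicator of each is a limit
    of the continuous ramps [F n], which have slope [n] from [a] on until they reach 1. Dynkin's
    lemma does the rest. *)
Lemma measurable_kern (M : R -> probability R R) :
  (forall f, continuous f -> (exists K, forall x, `|f x| <= K) ->
    continuous (fun s => expect (M s) f)) ->
  measurable_fun setT (kern M).
Proof.
move=> cM; apply: measurable_giry_codensity => //.
have mR : @measurable _ R = <<s @RGenOInfty.G R >> by exact: RGenOInfty.measurableE.
rewrite mR; apply: (dynkin_induction mR).
- move=> _ _ [a ->] [b ->]; exists (Num.max a b).
  by apply/seteqP; split=> x /=; rewrite !in_itv/= !andbT gt_max => /andP.
- rewrite (_ : kern M ^~ setT = cst 1%E); first exact: measurable_cst.
  by apply/funext => s; exact: probability_setT.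
- move=> _ [a ->].
  pose F n x : R := Num.min 1 (n%:R * Num.max 0 (x - a)).
  have F0 n x : 0 <= F n x.
    by rewrite /F le_min ler01/= mulr_ge0// le_max lexx.
  have F1 n x : `|F n x| <= 1 by rewrite ger0_norm// /F ge_min lexx.
  have cF n : continuous (F n).
    move=> x; apply: (@continuous_min R R (fun=> 1)
      (fun x => n%:R * Num.max 0 (x - a))); first exact: cvg_cst.
    apply: cvgM; first exact: cvg_cst.
    apply: (@continuous_max R R (fun=> 0) (fun x => x - a)).
      exact: cvg_cst.
    by apply: cvgB; [exact: cvg_id | exact: cvg_cst].
  have bF n : bmeas (F n) by apply: bmeas_cont => //; exists 1.
  have F_cvg x : F n x @[n --> \oo] --> (\1_(`]a, +oo[%classic) x : R).
    rewrite indicE mem_setE in_itv/= andbT; have [ax|xa] := ltP a x.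
      apply: cvg_near_cst; near=> n.
      rewrite /F min_l// max_r; last by rewrite subr_ge0 ltW.
      rewrite -ler_pdivrMr ?subr_gt0// mul1r.
      by near: n; exact: nbhs_infty_ger.
    rewrite (_ : (fun n => F n x) = cst 0); first exact: cvg_cst.
    apply/funext => n; rewrite /F max_l ?subr_le0// mulr0.
    by rewrite min_r.
  have mitv : measurable (`]a, +oo[%classic : set R) by exact: measurable_itv.
  apply: (eq_measurable_fun
    (fun s => (expect (M s) (\1_(`]a, +oo[%classic)))%:E)).
    by move=> s _; rewrite expect_indic.
  apply/measurable_EFinP.
  apply: (measurable_fun_cvg (h := fun n s => expect (M s) (F n))) => [n|s _].
    by apply: continuous_measurable_fun; apply: cM => //; exists 1.
  by have [] := expect_cvg (M s) bF F1 F_cvg.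
- move=> S mS hS; apply: (eq_measurable_fun (fun s => 1 - kern M s S)%E).
    by move=> s _; rewrite /kern/= probability_setC.
  by apply: emeasurable_funB => //; exact: measurable_cst.
- move=> F mF tF Fn.
  apply: (eq_measurable_fun (fun s => \sum_(0 <= k <oo) kern M s (F k))%E).
    by move=> s _; rewrite measure_semi_bigcup//; exact: bigcup_measurable.
  exact: ge0_emeasurable_sum.
Unshelve. all: by end_near.
Qed.

Definition mix (mu : giry R R) (K : R -> giry R R) (A : set R) : \bar R :=
  (\int[mu]_s K s A)%E.

Lemma giry_bindE (mu : giry R R) K (mK : measurable_fun setT K) A :
  measurable A -> giry_bind mu mK A = mix mu K A.
Proof.
move=> mA; rewrite /mix /giry_bind /= giry_int_map//.
exact: measurable_giry_ev.
Qed.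

Lemma ge0_integral_mix (mu nu : giry R R) K (f : R -> \bar R) :
  measurable_fun setT K -> meq nu (mix mu K) ->
  measurable_fun setT f -> (forall x, (0 <= f x)%E) ->
  (\int[nu]_x f x = \int[mu]_s \int[K s]_x f x)%E.
Proof.
move=> mK nuE mf f0; have := giry_int_bind mu mK mf f0.
rewrite /giry_int => <-; apply: eq_measure_integral => A mA _.
by exact: (eq_trans (nuE _ mA) (esym (giry_bindE mu mK mA))).
Qed.

Lemma expect_mix (mu nu : giry R R) K f :
  measurable_fun setT K -> meq nu (mix mu K) -> bmeas f ->
  bmeas (fun s => expect (K s) f) /\
  expect nu f = expect mu (fun s => expect (K s) f).
Proof.
(* Shifting [f] by a bound [M] makes it nonnegative; the constant [M] is itself a nonnegative
   instance and can be subtracted again. *)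
move=> mK nuE; wlog f0 : f / forall x, 0 <= f x => [hw|].
  move=> bf; have [_ [M hM]] := bf.
  have M0 : 0 <= M by apply: le_trans (hM 0).
  have bM : bmeas (cst M) by exact: bmeas_cst.
  have [] := hw (fun x => f x + cst M x).
  - by move=> x /=; have := hM x; rewrite ler_norml => /andP[]; lra.
  - exact: bmeasD.
  have [] := hw (cst M) => // b1 e1 b2 e2.
  have b3 : bmeas (fun s => expect (K s) f).
    have -> : (fun s => expect (K s) f) =
       fun s => expect (K s) (fun x => f x + cst M x) - expect (K s) (cst M).
      by apply/funext => s; rewrite expectD// addrK.
    exact: bmeasB.
  split => //.
  apply: (@addIr _ (expect nu (cst M))); rewrite -expectD// e2 e1 -expectD//.
  by congr expect; apply/funext => s; rewrite expectD.
move=> bf; have [mf [M hM]] := bf.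
have mEf : measurable_fun setT (fun x => (f x)%:E) by exact/measurable_EFinP.
have bK : bmeas (fun s => expect (K s) f).
  split.
    apply/measurable_EFinP.
    apply: (eq_measurable_fun (fun s => giry_int (K s) (fun x => (f x)%:E))).
      by move=> s _; rewrite /giry_int expectE.
    apply: (measurableT_comp (f := giry_int ^~ (fun x => (f x)%:E))) => //.
    by apply: measurable_giry_int => // x; rewrite lee_fin.
  exists M => s; rewrite ger0_norm; last first.
    by apply: Rintegral_ge0 => x _.
  have M0 : 0 <= M by apply: le_trans (hM 0).
  rewrite -lee_fin -expectE//.
  apply: (@le_trans _ _ (\int[K s]_x (cst M x)%:E)%E).
    apply: ge0_le_integral => //= x _; rewrite lee_fin//.
    by apply: le_trans (hM x); exact: ler_norm.
  have -> : (\int[K s]_x (cst M x)%:E = M%:E * K s setT)%E by rewrite /= integral_cst.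
  have := @sprobability_setT _ _ _ (K s) => K1.
  by apply: (@le_trans _ _ (M%:E * 1)%E); [apply: lee_pmul | rewrite mule1].
split=> //; have := ge0_integral_mix mK nuE mEf.
rewrite expectE//; under eq_integral do rewrite expectE//.
by rewrite expectE// => /(_ (fun x => f0 x)) [].
Qed.

Lemma add2_measurable : measurable_fun setT (fun z : R * R => z.1 + z.2).
Proof. by apply: measurable_funD; [exact: measurable_fst|exact: measurable_snd]. Qed.

Definition conv_giry (P1 P2 : giry R R) : giry R R :=
  giry_map add2_measurable (giry_prod (P1, P2)).

Lemma conv_giryE (P1 P2 : giry R R) : meq (conv_giry P1 P2) (convol P1 P2).
Proof.
move=> A mA; rewrite /conv_giry /giry_map /= /pushforward.
apply: eq_integral => x _ /=; congr (P2 _).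
by apply/seteqP; split => y /=; rewrite /xsection/= inE.
Qed.

Lemma measurable_conv_giry d (T : measurableType d) (K1 K2 : T -> giry R R) :
  measurable_fun setT K1 -> measurable_fun setT K2 ->
  measurable_fun setT (fun t => conv_giry (K1 t) (K2 t)).
Proof.
move=> m1 m2; apply: (measurableT_comp (f := giry_map add2_measurable)).
  exact: measurable_giry_map.
apply: (measurableT_comp (f := giry_prod)); first exact: measurable_giry_prod.
exact: measurable_fun_pair.
Qed.

Lemma ge0_integral_conv (P1 P2 P : giry R R) (f : R -> \bar R) :
  meq P (convol P1 P2) -> measurable_fun setT f -> (forall x, (0 <= f x)%E) ->
  (\int[P]_x f x = \int[P1]_x \int[P2]_y f (x + y)%R)%E.
Proof.
move=> PE mf f0.
transitivity (giry_int (conv_giry P1 P2) f).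
  apply: eq_measure_integral => A mA _.
  by exact: (eq_trans (PE _ mA) (esym (conv_giryE P1 P2 mA))).
rewrite /conv_giry giry_int_map// giry_int_prod1//; last by move=> x; exact: f0.
by apply: measurableT_comp => //; exact: add2_measurable.
Qed.

Lemma measurable_convol_section (P2 : giry R R) A : measurable A ->
  measurable_fun setT (fun x : R => P2 [set y | A (x + y)%R]).
Proof.
move=> mA; have mB : measurable ((fun z : R * R => z.1 + z.2) @^-1` A).
  by rewrite -[X in measurable X]setTI; exact: add2_measurable.
apply: (eq_measurable_fun (P2 \o xsection ((fun z : R * R => z.1 + z.2) @^-1` A))).
  move=> x _ /=; congr (P2 _).
  by apply/seteqP; split => y /=; rewrite /xsection/= inE.
exact: measurable_fun_xsection.
Qed.

Lemma measurable_shift (x : R) : measurable_fun setT (fun y : R => x + y).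
Proof. by apply: measurable_funD; [exact: measurable_cst | exact: measurable_id]. Qed.

(** A convolution is the mixture over [P1] of the translates of [P2], so this is [expect_mix] for
    the translation kernel. *)
Lemma expect_conv (P1 P2 P : giry R R) f : meq P (convol P1 P2) -> bmeas f ->
  bmeas (fun x => expect P2 (fun y => f (x + y))) /\
  expect P f = expect P1 (fun x => expect P2 (fun y => f (x + y))).
Proof.
move=> PE bf; pose K (x : R) : giry R R := giry_map (measurable_shift x) P2.
have mK : measurable_fun setT K.
  by apply: measurable_giry_codensity => // B mB; exact: measurable_convol_section.
have KE x : expect (K x) f = expect P2 (fun y => f (x + y)).
  have bf' := bmeas_comp (measurable_shift x) bf.
  rewrite /expect integral_pushforward//; first exact: measurable_shift.
  - by case: bf => mf _; apply/measurable_EFinP.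
  - exact: (bmeas_integrable P2 bf').
have [] := @expect_mix P1 P K f mK PE bf.
by rewrite (_ : (fun s => expect (K s) f) = (fun x => expect P2 (fun y => f (x + y))))//; apply/funext.
Qed.

(** The value is the mass given to [A] by the convolution of the Dirac mass at [z.2] with [K z.1], a
    composite of measurable operations on the Giry space. *)
Lemma measurable_joint_section (K : R -> giry R R) A : measurable_fun setT K ->
  measurable A ->
  measurable_fun setT (fun z : R * R => K z.1 [set y | A (z.2 + y)%R]).
Proof.
move=> mK mA.
apply: (eq_measurable_fun
    (fun z : R * R => giry_ev (conv_giry (giry_ret z.2) (K z.1)) A)).
  move=> z _; rewrite /giry_ev conv_giryE// /convol integral_dirac//.
    by rewrite diracT mul1e.
  exact: measurable_convol_section.
apply: (measurableT_comp (f := giry_ev ^~ A)); first exact: measurable_giry_ev.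
apply: measurable_conv_giry; last by apply: measurableT_comp.
by apply: measurableT_comp => //; exact: measurable_giry_ret.
Qed.

(* Given the semigroup property of [K], Fubini exchanges the time of the second
   factor with the position of the first. *)
Lemma mix_convol (K : R -> giry R R) (mu1 mu2 mu12 nu1 nu2 nu12 : probability R R) :
  measurable_fun setT K ->
  (forall s t, 0 <= s -> 0 <= t -> meq (K (s + t)) (convol (K s) (K t))) ->
  mu1 [set x | 0 <= x] = 1%E -> mu2 [set x | 0 <= x] = 1%E ->
  meq mu12 (convol mu1 mu2) ->
  meq nu1 (mix mu1 K) -> meq nu2 (mix mu2 K) -> meq nu12 (mix mu12 K) ->
  meq nu12 (convol nu1 nu2).
Proof.
move=> mK KD mu1T mu2T mu12E nu1E nu2E nu12E A mA.
have mRp : measurable [set x : R | 0 <= x].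
  rewrite (_ : [set x | _] = `[0, +oo[%classic); first exact: measurable_itv.
  by apply/seteqP; split=> x /=; rewrite in_itv/= andbT.
have mKA B : measurable B -> measurable_fun setT (fun s => K s B).
  move=> mB; apply: (measurableT_comp (f := giry_ev ^~ B)) => //.
  exact: measurable_giry_ev.
rewrite nu12E// /mix (ge0_integral_conv mu12E)//; last exact: mKA.
transitivity (\int[mu1]_s \int[mu2]_t convol (K s) (K t) A)%E.
  (* The semigroup law holds at nonnegative times only; these have full mass for [mu1] and [mu2]. *)
  apply: (eq_integral_full_measure mRp mu1T).
  - by move=> s; apply: integral_ge0 => t _.
  - by move=> s; apply: integral_ge0 => t _; apply: integral_ge0 => x _.
  move=> s s0; apply: (eq_integral_full_measure mRp mu2T) => //.
  - by move=> t; apply: integral_ge0 => x _.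
  by move=> t t0; apply: KD.
transitivity (\int[mu1]_s \int[K s]_x nu2 [set y | A (x + y)%R])%E; last first.
  rewrite /convol -(ge0_integral_mix mK nu1E)//.
  exact: measurable_convol_section.
apply: eq_integral => s _; rewrite /convol.
have mA' x : measurable [set y : R | A (x + y)].
  rewrite -[X in measurable X]setTI; exact: measurable_shift.
under [in RHS]eq_integral do rewrite nu2E//.
rewrite /mix.
have := @giry_int_prod1 _ _ _ _ R mu2 (K s) _ (measurable_joint_section mK mA).
have := @giry_int_prod2 _ _ _ _ R mu2 (K s) _ (measurable_joint_section mK mA).
rewrite /giry_int /= => e1 e2.
by rewrite -e1// -e2.
Qed.

End Mixture.

(** * Convolution powers and laws on the half-line *)

Section Convolution.
Variable R : realType.
Implicit Types (P Q : probability R R).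

(** Points of the Giry space are subprobabilities. Normalizing one of total mass 1 leaves it
    unchanged but yields a probability; the Dirac mass is only the default value of [mnormalize]. *)
Lemma giry_probability (m : giry R R) : m setT = 1%E ->
  exists P : probability R R, meq P m.
Proof.
move=> m1; exists (mnormalize m (\d_(0 : R))%R) => A mA.
rewrite /= /mnormalize [X in (X == 0)%E || _]m1/= onee_eq0/=.
have -> : (m [set: R])%E = 1%E by exact: m1.
by rewrite /= invr1 mule1.
Qed.

Lemma meq_sym (m m' : set R -> \bar R) : meq m m' -> meq m' m.
Proof. by move=> h A mA; rewrite h. Qed.

Lemma meq_trans (m1 m2 m3 : set R -> \bar R) : meq m1 m2 -> meq m2 m3 -> meq m1 m3.
Proof. by move=> h h' A mA; rewrite h// h'. Qed.

Lemma measurable_section (A : set R) (x : R) : measurable A ->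
  measurable [set y : R | A (x + y)].
Proof. by move=> mA; rewrite -[X in measurable X]setTI; exact: measurable_shift. Qed.

Lemma meq_convolr P (m m' : set R -> \bar R) : meq m m' ->
  meq (convol P m) (convol P m').
Proof.
move=> h A mA; apply: eq_integral => x _; apply: h; exact: measurable_section.
Qed.

Lemma convol_probability P Q : exists S : probability R R, meq S (convol P Q).
Proof.
have [|S hS] := @giry_probability (conv_giry P Q).
  rewrite conv_giryE// /convol.
  rewrite (_ : (fun _ => _) = cst 1%E); last by apply/funext => x; exact: probability_setT.
  by rewrite integral_cst// mul1e; exact: probability_setT.
by exists S; apply: meq_trans hS _; exact: conv_giryE.
Qed.

Lemma mix_probability P (K : R -> giry R R) : measurable_fun setT K ->
  (forall s, K s setT = 1%E) -> exists S : probability R R, meq S (mix P K).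
Proof.
move=> mK K1; have [|S hS] := @giry_probability (giry_bind P mK).
  rewrite giry_bindE// /mix.
  rewrite (_ : (fun _ => _) = cst 1%E); last by apply/funext => x.
  by rewrite integral_cst// mul1e; exact: probability_setT.
by exists S; apply: meq_trans hS _ => A mA; exact: giry_bindE.
Qed.

Lemma measurable_nonneg : measurable [set x : R | 0 <= x].
Proof.
rewrite (_ : [set x | _] = `[0, +oo[%classic); first exact: measurable_itv.
by apply/seteqP; split=> x /=; rewrite in_itv/= andbT.
Qed.

Lemma probability_sub1 P (A B : set R) : measurable A -> measurable B ->
  A `<=` B -> P A = 1%E -> P B = 1%E.
Proof.
move=> mA mB AB PA; apply/eqP; rewrite eq_le probability_le1//= -PA.
by rewrite le_measure// inE.
Qed.

Lemma convol_nonneg P Q (S : probability R R) : meq S (convol P Q) ->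
  P [set x | 0 <= x] = 1%E -> Q [set x | 0 <= x] = 1%E ->
  S [set x | 0 <= x] = 1%E.
Proof.
move=> SE P1 Q1; rewrite SE; last exact: measurable_nonneg.
rewrite /convol (eq_integral_full_measure (g := cst 1%E) measurable_nonneg P1)//.
  by rewrite integral_cst// mul1e; exact: probability_setT.
move=> x x0; apply: probability_sub1 Q1.
- exact: measurable_nonneg.
- exact: measurable_section measurable_nonneg.
- by move=> y /= y0; exact: addr_ge0.
Qed.

Lemma nconv_probability Q n : exists P : probability R R, meq P (nconv Q n).
Proof.
elim: n => [|n [P hP]]; first by exists (\d_(0 : R))%R.
have [S hS] := convol_probability Q P.
by exists S; apply: meq_trans hS _; exact: meq_convolr.
Qed.

Lemma nconv_nonneg Q n (P : probability R R) : Q [set x | 0 <= x] = 1%E ->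
  meq P (nconv Q n) -> P [set x | 0 <= x] = 1%E.
Proof.
move=> Q1; elim: n P => [|n IH] P hP.
  rewrite hP /=; last exact: measurable_nonneg.
  by rewrite diracE mem_set//=.
have [S hS] := nconv_probability Q n.
apply: (@convol_nonneg Q S) => //; last exact: IH.
by apply: meq_trans hP _; apply: meq_convolr; exact: meq_sym.
Qed.

(* [P (-oo, 0)] is at least [Q (-oo, 0) ^ n]. *)
Lemma nconv_root_nonneg Q n (P : probability R R) : (0 < n)%N ->
  meq P (nconv Q n) -> P [set x | 0 <= x] = 1%E -> Q [set x | 0 <= x] = 1%E.
Proof.
case: n => // n _ hP P1.
pose N := [set x : R | x < 0]; pose L := [set x : R | x <= 0].
have mN : measurable N.
  rewrite (_ : N = `]-oo, 0[%classic); first exact: measurable_itv.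
  by apply/seteqP; split=> x /=; rewrite in_itv.
have mL : measurable L.
  rewrite (_ : L = `]-oo, 0]%classic); first exact: measurable_itv.
  by apply/seteqP; split=> x /=; rewrite in_itv.
have NE : N = ~` [set x : R | 0 <= x].
  by apply/seteqP; split=> x /=; rewrite /N/=; [move=> x0; apply/negP; rewrite -ltNge|move/negP; rewrite -ltNge].
(* A negative summand plus a nonpositive one is negative. The other summands are tested on the
   closed half-line [L] because the empty sum, the Dirac mass at 0, charges [L] but not [N]. *)
have step m (S : probability R R) : meq S (nconv Q m.+1) ->
    (Q N * nconv Q m L <= S N)%E.
  move=> hS; rewrite hS//= /convol.
  have [T hT] := nconv_probability Q m.
  rewrite -(hT _ mL).
  apply: (@le_trans _ _ (\int[Q]_x ((T L) * (\1_N x)%:E))%E).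
    rewrite ge0_integralZl//; last exact/measurable_EFinP/measurable_indic.
    by rewrite integral_indic// setIT muleC.
  apply: ge0_le_integral => //.
  - by move=> x _; apply: mule_ge0.
  - apply: emeasurable_funM; first exact: measurable_cst.
    exact/measurable_EFinP/measurable_indic.
  - apply: (eq_measurable_fun (fun x : R => T [set y | N (x + y)%R])).
      by move=> x _; rewrite hT//; exact: measurable_section.
    exact: (measurable_convol_section (T : giry R R)).
  - move=> x _; rewrite indicE; have [/set_mem xN|_] := boolP (x \in N); last by rewrite mule0 -hT//; exact: measurable_section.
    rewrite mule1 -hT; last exact: measurable_section.
    apply: le_measure; rewrite ?inE//; first exact: measurable_section.
    by move=> y; rewrite /L /N/= => y0; move: xN; rewrite /N/=; lra.
have PN : P N = 0%E.
  by rewrite NE probability_setC ?P1 ?subee//; exact: measurable_nonneg.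
have QN : Q N = 0%E.
  apply/eqP/contraT => QN.
  have QN0 : (0 < Q N)%E by rewrite lt0e QN/=.
  have pos m : (0 < nconv Q m L)%E.
    elim: m => [|m IH]; first by rewrite /= diracE mem_set//= /L/=.
    have [S hS] := nconv_probability Q m.+1.
    apply: (@lt_le_trans _ _ (Q N * nconv Q m L)%E); first exact: mule_gt0.
    apply: le_trans (step _ _ hS) _; rewrite -hS//.
    by apply: le_measure; rewrite ?inE// => x; rewrite /N /L/=; exact: ltW.
  by have := step _ _ hP; rewrite PN leNgt mule_gt0.
have := probability_setC Q mN; rewrite QN sube0 NE setCK.
by [].
Qed.

End Convolution.

(** * Existence, infinite divisibility, continuity and multiplicativity of the subordinated laws *)

Section Semigroup.
Variables (R : realType) (muL : probability R R) (mus : R -> probability R R).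
Hypothesis musL : levy_semigroup muL mus.

(** Freezing the family at time 0 for negative [s] makes it weakly continuous on the whole line,
    hence a measurable kernel. *)
Definition forward (s : R) : probability R R := mus (Num.max s 0).

Lemma forwardE s : 0 <= s -> forward s = mus s.
Proof. by move=> s0; rewrite /forward max_l. Qed.

Lemma continuous_expect_forward f : continuous f ->
  (exists K, forall x, `|f x| <= K) ->
  continuous (fun s => expect (forward s) f).
Proof.
move=> cf bf s; apply/(@cvg_nbhsP _ R^o) => u us.
have [_ _ _ h] := musL.
have := h (Num.max s 0) (fun n => Num.max (u n) 0).
move=> /(_ _ _ _)/weak_cvgP h'; apply: h' => //.
- by rewrite le_max lexx orbT.
- by move=> n; rewrite le_max lexx orbT.
- have cm : continuous (fun x : R => Num.max x 0).
    by move=> x; apply: (@continuous_max R R id (fun=> 0)); [exact: cvg_id|exact: cvg_cst].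
  exact: (continuous_cvg _ (cm s) us).
Qed.

Definition fkern := kern forward.

Lemma measurable_fkern : measurable_fun setT fkern.
Proof. by apply: measurable_kern; exact: continuous_expect_forward. Qed.

Lemma fkernD s t : 0 <= s -> 0 <= t ->
  meq (fkern (s + t)) (convol (fkern s) (fkern t)).
Proof.
move=> s0 t0; rewrite /fkern /kern !forwardE ?addr_ge0//.
by have [_ _ h _] := musL; exact: h.
Qed.

Lemma is_LambdaE (muT nu : probability R R) : muT [set x | 0 <= x] = 1%E ->
  is_Lambda mus muT nu <-> meq nu (mix muT fkern).
Proof.
move=> T1; suff h : meq (fun A => \int[muT]_s mus s A)%E (mix muT fkern).
  by split=> hn; [exact: meq_trans hn h|exact: meq_trans hn (meq_sym h)].
move=> A mA; apply: (@eq_integral_full_measure R muT [set x | 0 <= x]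
  (fun s => mus s A) (fun s => fkern s A)) => //; first exact: measurable_nonneg.
by move=> x x0; rewrite /fkern /kern forwardE.
Qed.

Lemma expect_Lambda (muT nu : probability R R) f :
  muT [set x | 0 <= x] = 1%E -> is_Lambda mus muT nu -> bmeas f ->
  bmeas (fun s => expect (forward s) f) /\
  expect nu f = expect muT (fun s => expect (forward s) f).
Proof. by move=> T1 /(is_LambdaE nu T1) nuE; exact: (expect_mix measurable_fkern nuE). Qed.

Lemma Lambda_convol (mu1 mu2 mu12 nu1 nu2 nu12 : probability R R) :
  mu1 [set x | 0 <= x] = 1%E -> mu2 [set x | 0 <= x] = 1%E ->
  meq mu12 (convol mu1 mu2) ->
  is_Lambda mus mu1 nu1 -> is_Lambda mus mu2 nu2 -> is_Lambda mus mu12 nu12 ->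
  meq nu12 (convol nu1 nu2).
Proof.
move=> p1 p2 E12; have p12 := convol_nonneg E12 p1 p2.
move=> /(is_LambdaE _ p1) h1 /(is_LambdaE _ p2) h2 /(is_LambdaE _ p12) h12.
exact: (mix_convol measurable_fkern fkernD p1 p2 E12 h1 h2 h12).
Qed.

Lemma Lambda_exists (muT : probability R R) : muT [set x | 0 <= x] = 1%E ->
  exists nu, is_Lambda mus muT nu.
Proof.
move=> T1; have [|nu hnu] := mix_probability muT measurable_fkern.
  by move=> s; exact: probability_setT.
by exists nu; apply/(is_LambdaE _ T1).
Qed.

(** By multiplicativity, the image of an n-th convolution root [Q] of [muT] is an n-th root of [nu].
    For [Q] to have an image it must live on the half-line, which it inherits from [muT]. *)
Lemma Lambda_ID (muT nu : probability R R) : is_IDplus muT ->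
  is_Lambda mus muT nu -> is_ID nu.
Proof.
move=> [ID T1] nuE n n0; have [Q hQ] := ID n n0.
have Q1 := nconv_root_nonneg n0 hQ T1.
have [nuQ hnuQ] := Lambda_exists Q1.
exists nuQ.
suff h k (P N : probability R R) : meq P (nconv Q k) -> is_Lambda mus P N ->
    meq N (nconv nuQ k) by exact: h hQ nuE.
elim: k P N => [|k IH] P N hP.
  move=> /(is_LambdaE _ (nconv_nonneg Q1 hP)) hN A mA; rewrite hN// /mix.
  rewrite (eq_measure_integral (\d_(0 : R))%R); last by move=> B mB _; exact: hP.
  rewrite integral_dirac//; last first.
    apply: (measurableT_comp (f := giry_ev ^~ A)); first exact: measurable_giry_ev.
    exact: measurable_fkern.
  rewrite diracT mul1e /fkern /kern forwardE//.
  by have [h _ _ _] := musL; exact: h.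
move=> hN; have [S hS] := nconv_probability Q k.
have S1 := nconv_nonneg Q1 hS.
have [nuS hnuS] := Lambda_exists S1.
apply: (@meq_trans _ _ (convol nuQ nuS)).
  apply: (Lambda_convol Q1 S1 _ hnuQ hnuS hN).
  by apply: meq_trans hP _; apply: meq_convolr; exact: meq_sym.
exact/meq_convolr/(IH _ _ hS hnuS).
Qed.

(** Testing [nu] against [f] amounts to testing [mu] against the map from [s] to the expectation of
    [f] under [forward mus s], which is again bounded and continuous. *)
Lemma Lambda_continuous (mun : nat -> probability R R) (mu : probability R R)
    (nun : nat -> probability R R) (nu : probability R R) :
  (forall n, mun n [set x | 0 <= x] = 1%E) -> mu [set x | 0 <= x] = 1%E ->
  (forall n, is_Lambda mus (mun n) (nun n)) -> is_Lambda mus mu nu ->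
  weak_cvg mun mu -> weak_cvg nun nu.
Proof.
move=> mun1 mu1 hn h /weak_cvgP cmu; apply/weak_cvgP => f cf bf.
have bmf := bmeas_cont cf bf.
have [[mg bg] ->] := expect_Lambda mu1 h bmf.
have -> : (fun n => expect (nun n) f) =
    fun n => expect (mun n) (fun s => expect (forward s) f).
  by apply/funext => n; have [_ ->] := expect_Lambda (mun1 n) (hn n) bmf.
by apply: cmu => //; exact: continuous_expect_forward.
Qed.

End Semigroup.

(** * Mean value bounds, one-parameter semigroups in the plane, first hitting points *)

Section RealAnalysis.
Variable R : realType.
Implicit Types (f : R -> R) (x y s u : R).

(** The points are unordered, as the increments met later have either sign. The bound by the maximum
    controls [expR c]; the distance bound allows [c] to be replaced by [x] at a Lipschitz cost. *)
Lemma mvt_between f (df : R -> R) x y : (forall z : R, is_derive z 1 f (df z)) ->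
  exists c, [/\ c <= Num.max x y, `|c - x| <= `|y - x| & f y - f x = df c * (y - x)].
Proof.
move=> fdf.
have cf z : {for z, continuous f}.
  by apply: differentiable_continuous; apply/derivable1_diffP; exact: ex_derive.
have cfw a b : {within `[a, b], continuous f}.
  by apply: continuous_subspaceT => z; exact: cf.
have [xy|yx] := leP x y.
  have [c + e] := MVT_segment xy (fun z _ => fdf z) (cfw _ _).
  rewrite in_itv/= => /andP[xc cy]; exists c; split=> //.
  by rewrite !ger0_norm ?subr_ge0// lerD2r.
have [c + e] := MVT_segment (ltW yx) (fun z _ => fdf z) (cfw _ _).
rewrite in_itv/= => /andP[yc cx]; exists c; split=> //.
  by rewrite !ler0_norm ?subr_le0 ?(ltW yx)//; lra.
by rewrite -[LHS]opprB e; ring.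
Qed.

Lemma cos_mvt x y : exists c, `|c - x| <= `|y - x| /\ cos y - cos x = - sin c * (y - x).
Proof.
suff [c [_]] : exists c, [/\ c <= Num.max x y, `|c - x| <= `|y - x| &
    cos y - cos x = - sin c * (y - x)] by exists c.
by apply: (@mvt_between _ (fun z => - sin z)) => z; exact: is_derive_cos.
Qed.

Lemma sin_mvt x y : exists c, `|c - x| <= `|y - x| /\ sin y - sin x = cos c * (y - x).
Proof.
suff [c [_]] : exists c, [/\ c <= Num.max x y, `|c - x| <= `|y - x| &
    sin y - sin x = cos c * (y - x)] by exists c.
by apply: (@mvt_between _ cos) => z; exact: is_derive_sin.
Qed.

Lemma expR_mvt x y : exists c,
  [/\ c <= Num.max x y, `|c - x| <= `|y - x| & expR y - expR x = expR c * (y - x)].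
Proof. by apply: (@mvt_between _ expR) => z; exact: is_derive_expR. Qed.

Lemma oneBcos_le y : 1 - cos y <= `|y|.
Proof.
have [c [_]] := cos_mvt 0 y; rewrite cos0 subr0 => e.
rewrite -opprB e mulNr opprK; apply: le_trans (ler_norm _) _.
by rewrite normrM ler_piMl// sin_max.
Qed.

Lemma cos_eq1_small (t : R) : `|t| < @pi R -> cos t = 1 -> t = 0.
Proof.
move=> tpi; rewrite -cos_norm -[RHS]cos0 => /cos_inj.
rewrite !in_itv/= normr_ge0 lexx pi_ge0 (ltW tpi) => /(_ isT isT) /eqP.
by rewrite normr_eq0 => /eqP.
Qed.

(** For z = c + i d and z' = c' + i d' the equations say z^2 = z'^2, and z + z' has positive real
    part, hence is invertible. [h1] and [h2] are the real and imaginary parts of z^2 - z'^2 times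
    the conjugate of z + z'. *)
Lemma sqrtc_uniq (c d c' d' : R) : 0 < c -> 0 < c' ->
  c * c - d * d = c' * c' - d' * d' -> d * c + c * d = d' * c' + c' * d' ->
  c = c' /\ d = d'.
Proof.
move=> c0 c'0 e1 e2.
have pq : (c + c') ^+ 2 + (d + d') ^+ 2 != 0.
  by apply: lt0r_neq0; apply: ltr_pwDl; [apply: exprn_gt0; exact: addr_gt0|exact: sqr_ge0].
have h1 : (c - c') * ((c + c') ^+ 2 + (d + d') ^+ 2) = 0.
  have -> : (c - c') * ((c + c') ^+ 2 + (d + d') ^+ 2) =
    (c + c') * ((c * c - d * d) - (c' * c' - d' * d')) +
    (d + d') * ((d * c + c * d) - (d' * c' + c' * d')) by ring.
  by rewrite e1 e2 !subrr !mulr0 addr0.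
have h2 : (d - d') * ((c + c') ^+ 2 + (d + d') ^+ 2) = 0.
  have -> : (d - d') * ((c + c') ^+ 2 + (d + d') ^+ 2) =
    (c + c') * ((d * c + c * d) - (d' * c' + c' * d')) -
    (d + d') * ((c * c - d * d) - (c' * c' - d' * d')) by ring.
  by rewrite e1 e2 !subrr !mulr0 subr0.
split; apply/eqP; rewrite -subr_eq0.
  by move/eqP: h1; rewrite mulf_eq0 (negbTE pq) orbF.
by move/eqP: h2; rewrite mulf_eq0 (negbTE pq) orbF.
Qed.

(* [c + i d] is a continuous one-parameter semigroup in the complex numbers. *)
Record rotation_semigroup (c d : R -> R) : Prop := RotationSemigroup {
  rot_c0 : c 0 = 1;
  rot_d0 : d 0 = 0;
  rot_cD : forall s t, 0 <= s -> 0 <= t -> c (s + t) = c s * c t - d s * d t;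
  rot_dD : forall s t, 0 <= s -> 0 <= t -> d (s + t) = d s * c t + c s * d t;
  rot_cc : forall s (u : nat -> R), 0 <= s -> (forall n, 0 <= u n) ->
    u n @[n --> \oo] --> s -> c (u n) @[n --> \oo] --> c s;
  rot_cd : forall s (u : nat -> R), 0 <= s -> (forall n, 0 <= u n) ->
    u n @[n --> \oo] --> s -> d (u n) @[n --> \oo] --> d s }.

Lemma dyadic_approx s : 0 <= s ->
  (Num.truncn (s * 2 ^+ n))%:R / 2 ^+ n @[n --> \oo] --> s.
Proof.
move=> s0; apply/cvgrPdist_le => e e0; near=> n.
have p0 : 0 < 2 ^+ n :> R by exact: exprn_gt0.
have /truncn_itv /andP[h1 h2] : 0 <= s * 2 ^+ n by apply: mulr_ge0 => //; exact: ltW.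
rewrite ger0_norm; last by rewrite subr_ge0 ler_pdivrMr.
have h3 : s < (Num.truncn (s * 2 ^+ n)).+1%:R / 2 ^+ n by rewrite ltr_pdivlMr.
rewrite -addn1 natrD mulrDl mul1r in h3.
suff : 2 ^- n <= e by move: h3; lra.
rewrite invf_ple ?posrE//.
have : e^-1 <= n%:R by near: n; exact: nbhs_infty_ger.
by move=> /le_trans; apply; rewrite -natrX ler_nat; exact/ltnW/ltn_expl.
Unshelve. all: by end_near. Qed.

(* The semigroups agree at [2 ^- n] because square roots with positive real part are unique,
   hence at all dyadic times, and by continuity everywhere. *)
Lemma rotation_semigroup_uniq (c d c' d' : R -> R) :
  rotation_semigroup c d -> rotation_semigroup c' d' ->
  c 1 = c' 1 -> d 1 = d' 1 ->
  (forall s, 0 <= s <= 1 -> 0 < c s) -> (forall s, 0 <= s <= 1 -> 0 < c' s) ->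
  forall s, 0 <= s -> c s = c' s /\ d s = d' s.
Proof.
move=> rs rs' c1 d1 cp cp'.
have half n : c (2 ^- n) = c' (2 ^- n) /\ d (2 ^- n) = d' (2 ^- n).
  elim: n => [|n [IHc IHd]]; first by rewrite expr0 invr1.
  have p0 : 0 <= 2 ^- n.+1 :> R by rewrite invr_ge0 exprn_ge0.
  have p1 : 2 ^- n.+1 <= 1 :> R by rewrite invf_le1 ?exprn_gt0// exprn_ege1// ler1n.
  have e : 2 ^- n = 2 ^- n.+1 + 2 ^- n.+1 :> R.
    rewrite exprS invfM -mulrDl (_ : 2^-1 + 2^-1 = 1) ?mul1r//; lra.
  apply: sqrtc_uniq; [by apply: cp; rewrite p0|by apply: cp'; rewrite p0| |].
  - by rewrite -(rot_cD rs)// -(rot_cD rs')// -e.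
  - by rewrite -(rot_dD rs)// -(rot_dD rs')// -e.
have dyad k n : c (k%:R / 2 ^+ n) = c' (k%:R / 2 ^+ n) /\
    d (k%:R / 2 ^+ n) = d' (k%:R / 2 ^+ n).
  elim: k => [|k [IHc IHd]].
    by rewrite mul0r (rot_c0 rs) (rot_c0 rs') (rot_d0 rs) (rot_d0 rs').
  have [hc hd] := half n.
  have p0 : 0 <= 2 ^- n :> R by rewrite invr_ge0 exprn_ge0.
  have k0 : 0 <= k%:R / 2 ^+ n :> R by rewrite mulr_ge0.
  rewrite -addn1 natrD mulrDl mul1r.
  by rewrite (rot_cD rs)// (rot_cD rs')// (rot_dD rs)// (rot_dD rs')// IHc IHd hc hd.
move=> s s0; have as_ := dyadic_approx s0.
have pos n : 0 <= (Num.truncn (s * 2 ^+ n))%:R / 2 ^+ n :> R.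
  by rewrite mulr_ge0// invr_ge0 exprn_ge0.
split.
  have := rot_cc rs s0 pos as_; have := rot_cc rs' s0 pos as_.
  rewrite (_ : (fun _ => c' _) = fun n => c ((Num.truncn (s * 2 ^+ n))%:R / 2 ^+ n)).
    by move=> h2 h1; rewrite -(cvg_lim _ h1)// -(cvg_lim _ h2).
  by apply/funext => n; have [] := dyad (Num.truncn (s * 2 ^+ n)) n.
have := rot_cd rs s0 pos as_; have := rot_cd rs' s0 pos as_.
rewrite (_ : (fun _ => d' _) = fun n => d ((Num.truncn (s * 2 ^+ n))%:R / 2 ^+ n)).
  by move=> h2 h1; rewrite -(cvg_lim _ h1)// -(cvg_lim _ h2).
by apply/funext => n; have [] := dyad (Num.truncn (s * 2 ^+ n)) n.
Qed.

Lemma rotation_semigroup_exp (a b : R) :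
  rotation_semigroup (fun s => expR (- (s * a)) * cos (s * b))
                     (fun s => expR (- (s * a)) * sin (s * b)).
Proof.
have ce : continuous (fun s => expR (- (s * a))).
  move=> s; apply: (continuous_comp (f := fun s => - (s * a))); last exact: continuous_expR.
  by apply: cvgN; apply: cvgM; [exact: cvg_id|exact: cvg_cst].
have cb : continuous (fun s : R => s * b).
  by move=> s; apply: cvgM; [exact: cvg_id|exact: cvg_cst].
have ccos : continuous (fun s : R => cos (s * b)).
  by move=> s; apply: continuous_comp; [exact: cb|exact: continuous_cos].
have csin : continuous (fun s : R => sin (s * b)).
  by move=> s; apply: continuous_comp; [exact: cb|exact: continuous_sin].
split.
- by rewrite !mul0r oppr0 expR0 cos0 mul1r.
- by rewrite !mul0r sin0 mulr0.
- by move=> s t _ _; rewrite !mulrDl opprD expRD cosD; ring.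
- by move=> s t _ _; rewrite !mulrDl opprD expRD sinD; ring.
- move=> s u _ _ us; apply: cvgM; first exact: (continuous_cvg _ (ce s) us).
  exact: (continuous_cvg _ (ccos s) us).
- move=> s u _ _ us; apply: cvgM; first exact: (continuous_cvg _ (ce s) us).
  exact: (continuous_cvg _ (csin s) us).
Qed.

Lemma polar_form (c d : R) : 0 < c ->
  expR (ln (c ^+ 2 + d ^+ 2) / 2) * cos (atan (d / c)) = c /\
  expR (ln (c ^+ 2 + d ^+ 2) / 2) * sin (atan (d / c)) = d.
Proof.
move=> c0; set r := expR _; set t := atan _.
have r0 : 0 < r by exact: expR_gt0.
have n0 : 0 < c ^+ 2 + d ^+ 2 by apply: ltr_pwDl; [exact: exprn_gt0|exact: sqr_ge0].
have r2 : r ^+ 2 = c ^+ 2 + d ^+ 2.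
  by rewrite /r -expRM_natl mulrC divfK ?lnK// pnatr_eq0.
have ct : 0 < cos t by apply: cos_gt0_pihalf; rewrite atan_gtNpi2 atan_ltpi2.
have st : sin t = d / c * cos t.
  by have := atanK (d / c); rewrite -/t /tan => <-; rewrite divfK// gt_eqF.
have e : r * cos t = c.
  apply/eqP; rewrite -(@eqrXn2 _ 2) ?mulr_ge0 ?ltW//; apply/eqP.
  rewrite exprMn r2; have := cos2Dsin2 t; rewrite st => h.
  have -> : (c ^+ 2 + d ^+ 2) * cos t ^+ 2 = c ^+ 2 * (cos t ^+ 2 + (d / c * cos t) ^+ 2).
    by field; rewrite gt_eqF.
  by rewrite h mulr1.
by split => //; rewrite st mulrCA e divfK// gt_eqF.
Qed.

(** [v] is the infimum of the points of [[0, x]] where [a] is at least [l]. Continuity places it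
    among them, and [a 0 < l] keeps it off 0. *)
Lemma first_hit (a : R -> R) (x l : R) : 0 <= x ->
  (forall y, 0 <= y <= x -> {for y, continuous a}) -> a 0 < l -> l <= a x ->
  exists v, [/\ 0 < v, v <= x, l <= a v & forall w, 0 <= w -> w < v -> a w < l].
Proof.
move=> x0 ca a0 lx; pose S := [set y | 0 <= y <= x /\ l <= a y].
have Sx : S x by split; rewrite ?x0/=.
have lbS : has_lbound S by exists 0 => y [/andP[]].
have hiS : has_inf S by split; [exists x|].
pose v := inf S.
have v0 : 0 <= v by apply: lb_le_inf; [exists x|move=> y [/andP[]]].
have vx : v <= x by exact: ge_inf.
have lv : l <= a v.
  rewrite leNgt; apply/negP => avl.
  have : \forall y \near v, a y < l.
    have cav : a y @[y --> v] --> a v by apply: ca; rewrite v0.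
    exact: (cvgr_lt (a v) cav).
  move=> /nbhs_ballP[e /= e0 he].
  have [y Sy yv] := inf_adherent e0 hiS.
  have vy : v <= y by exact: ge_inf.
  have : a y < l.
    by apply: he; rewrite /ball/= ler0_norm ?subr_le0//; move: yv; rewrite -/v; lra.
  by case: Sy => _ ly; rewrite ltNge ly.
exists v; split=> //.
  by rewrite lt_neqAle v0 andbT; apply/eqP => v0'; move: lv; rewrite -v0' leNgt a0.
move=> w w0 wv; rewrite ltNge; apply/negP => lw.
have : v <= w by apply: ge_inf => //; split=> //; rewrite w0 (le_trans (ltW wv)).
by rewrite leNgt wv.
Qed.

End RealAnalysis.

(** * Characteristic functions in real form *)

Section CharacteristicFunction.
Variable R : realType.
Implicit Types (P Q S : probability R R) (u : R).

(** Real part of the characteristic function at [u]; [chars] is the imaginary part. *)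
Definition charc (P : set R -> \bar R) u := expect P (fun x => cos (u * x)).
Definition chars (P : set R -> \bar R) u := expect P (fun x => sin (u * x)).

Lemma continuous_mulu u : continuous (fun x : R => u * x).
Proof. by move=> x; apply: cvgM; [exact: cvg_cst|exact: cvg_id]. Qed.

Lemma continuous_cosu u : continuous (fun x : R => cos (u * x)).
Proof. by move=> x; apply: continuous_comp; [exact: continuous_mulu|exact: continuous_cos]. Qed.

Lemma continuous_sinu u : continuous (fun x : R => sin (u * x)).
Proof. by move=> x; apply: continuous_comp; [exact: continuous_mulu|exact: continuous_sin]. Qed.

Lemma bmeas_cos u : bmeas (fun x : R => cos (u * x)).
Proof. by apply: bmeas_cont; [exact: continuous_cosu|exists 1 => x; exact: cos_max]. Qed.

Lemma bmeas_sin u : bmeas (fun x : R => sin (u * x)).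
Proof. by apply: bmeas_cont; [exact: continuous_sinu|exists 1 => x; exact: sin_max]. Qed.

Lemma charc_conv P Q S u : meq S (convol P Q) ->
  charc S u = charc P u * charc Q u - chars P u * chars Q u.
Proof.
move=> SE; have [_ e] := expect_conv SE (bmeas_cos u); rewrite /charc {1}e.
have -> : (fun x => expect Q (fun y => cos (u * (x + y)))) =
    (fun x => charc Q u * cos (u * x) - chars Q u * sin (u * x)).
  apply/funext => x.
  have -> : (fun y => cos (u * (x + y))) =
      (fun y => cos (u * x) * cos (u * y) - sin (u * x) * sin (u * y)).
    by apply/funext => y; rewrite mulrDr cosD.
  rewrite expectB; [|exact/bmeasZ/bmeas_cos|exact/bmeasZ/bmeas_sin].
  rewrite !expectZ; [|exact: bmeas_sin|exact: bmeas_cos].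
  by rewrite /charc /chars; ring.
rewrite expectB; [|exact/bmeasZ/bmeas_cos|exact/bmeasZ/bmeas_sin].
rewrite !expectZ; [|exact: bmeas_sin|exact: bmeas_cos].
by rewrite /charc /chars; ring.
Qed.

Lemma chars_conv P Q S u : meq S (convol P Q) ->
  chars S u = chars P u * charc Q u + charc P u * chars Q u.
Proof.
move=> SE; have [_ e] := expect_conv SE (bmeas_sin u); rewrite /chars {1}e.
have -> : (fun x => expect Q (fun y => sin (u * (x + y)))) =
    (fun x => charc Q u * sin (u * x) + chars Q u * cos (u * x)).
  apply/funext => x.
  have -> : (fun y => sin (u * (x + y))) =
      (fun y => sin (u * x) * cos (u * y) + cos (u * x) * sin (u * y)).
    by apply/funext => y; rewrite mulrDr sinD.
  rewrite expectD; [|exact/bmeasZ/bmeas_cos|exact/bmeasZ/bmeas_sin].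
  rewrite !expectZ; [|exact: bmeas_sin|exact: bmeas_cos].
  by rewrite /charc /chars; ring.
rewrite expectD; [|exact/bmeasZ/bmeas_sin|exact/bmeasZ/bmeas_cos].
rewrite !expectZ; [|exact: bmeas_cos|exact: bmeas_sin].
by rewrite /charc /chars; ring.
Qed.

Lemma dot_unit_le (c d x y : R) : x ^+ 2 + y ^+ 2 = 1 ->
  c * x + d * y <= (c ^+ 2 + d ^+ 2 + 1) / 2.
Proof.
move=> e; have h1 := sqr_ge0 (c - x); have h2 := sqr_ge0 (d - y).
suff : 0 <= (c - x) ^+ 2 + (d - y) ^+ 2 -> c * x + d * y <= (c ^+ 2 + d ^+ 2 + (x ^+ 2 + y ^+ 2)) / 2.
  by rewrite e; apply; exact: addr_ge0.
by rewrite !expr2; nra.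
Qed.

(** With z = c + i d, the scalar product of z and exp (i u x) has expectation |z|^2, and pointwise
    it is at most (|z|^2 + 1) / 2. *)
Lemma char_norm_le1 P u : charc P u ^+ 2 + chars P u ^+ 2 <= 1.
Proof.
set c := charc P u; set d := chars P u.
have b1 : bmeas (fun x => c * cos (u * x)) by exact/bmeasZ/bmeas_cos.
have b2 : bmeas (fun x => d * sin (u * x)) by exact/bmeasZ/bmeas_sin.
have : expect P (fun x => c * cos (u * x) + d * sin (u * x)) <=
    expect P (cst ((c ^+ 2 + d ^+ 2 + 1) / 2)).
  apply: le_expect; [exact: bmeasD|exact: bmeas_cst|move=> x /=].
  exact/dot_unit_le/cos2Dsin2.
rewrite expect_cst expectD// !expectZ; [|exact: bmeas_sin|exact: bmeas_cos].
rewrite -/(charc P u) -/(chars P u) -/c -/d -!expr2.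
by move: (c ^+ 2 + d ^+ 2) => z; lra.
Qed.

Lemma continuous_charc P : continuous (charc P).
Proof.
move=> u; apply/(@cvg_nbhsP _ R^o) => v vu.
have [] := expect_cvg P (F := fun n x => cos (v n * x)) (f := fun x => cos (u * x)) (M := 1).
- by move=> n; exact: bmeas_cos.
- by move=> n x; exact: cos_max.
- move=> x; apply: continuous_cvg; first exact: continuous_cos.
  by apply: cvgM; [exact: vu|exact: cvg_cst].
- by [].
Qed.

Lemma continuous_chars P : continuous (chars P).
Proof.
move=> u; apply/(@cvg_nbhsP _ R^o) => v vu.
have [] := expect_cvg P (F := fun n x => sin (v n * x)) (f := fun x => sin (u * x)) (M := 1).
- by move=> n; exact: bmeas_sin.
- by move=> n x; exact: sin_max.
- move=> x; apply: continuous_cvg; first exact: continuous_sin.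
  by apply: cvgM; [exact: vu|exact: cvg_cst].
- by [].
Qed.

Lemma charc0 P : charc P 0 = 1.
Proof.
rewrite /charc (_ : (fun _ => _) = cst 1) ?expect_cst//.
by apply/funext => x; rewrite mul0r cos0.
Qed.

Lemma chars0 P : chars P 0 = 0.
Proof.
rewrite /chars (_ : (fun _ => _) = cst 0) ?expect_cst//.
by apply/funext => x; rewrite mul0r sin0.
Qed.

Lemma expect1_ae P (f : R -> R) : bmeas f -> (forall x, f x <= 1) ->
  expect P f = 1 -> {ae P, forall x, f x = 1}.
Proof.
move=> bf f1 Ef.
have b1 : bmeas (fun x => 1 - f x) by apply: bmeasB => //; exact: bmeas_cst.
have mg : measurable_fun setT (fun x => (1 - f x)%:E).
  by apply/measurable_EFinP; case: b1.
have : (\int[P]_x `|(1 - f x)%:E| = 0)%E.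
  have -> : (fun x => `|(1 - f x)%:E|)%E = (fun x => (1 - f x)%:E).
    by apply/funext => x; rewrite /= ger0_norm// subr_ge0.
  by rewrite expectE// expectB//; [rewrite expect_cst Ef subrr|exact: bmeas_cst].
move/(ae_eq_integral_abs P measurableT mg); apply: filterS => x /(_ I) [] /eqP.
by rewrite subr_eq0 => /eqP.
Qed.

Lemma probability_ae P (p : R -> Prop) : {ae P, forall x, p x} ->
  exists x, p x.
Proof.
move=> aep; apply: contrapT => np.
have : {ae P, forall x : R, False}.
  by apply: filterS aep => x px; apply: np; exists x.
move=> [N [mN N0 sN]].
have NT : N = setT by apply/seteqP; split => // x _; apply: sN.
move: N0; rewrite NT; have -> : P setT = 1%E by exact: probability_setT.
by move/eqP; rewrite onee_eq0.
Qed.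

Lemma meq_dirac P (x0 : R) : {ae P, forall x, x = x0} -> meq P (\d_x0)%R.
Proof.
move=> aex; have null B : measurable B -> ~ B x0 -> P B = 0%E.
  move=> mB nB; apply: measure_negligible => //; apply: negligibleS aex.
  by move=> x Bx xx0; apply: nB; rewrite -xx0.
move=> A mA; rewrite /= diracE.
have [/set_mem xA|/negP xA] := boolP (x0 \in A); last first.
  by rewrite null// => Ax; apply: xA; exact: mem_set.
have := probability_setC P mA.
rewrite null//; last exact: measurableC.
have : (P A <= 1)%E by exact: probability_le1.
have : (0 <= P A)%E by [].
case: (P A) => //= r _ _ /eqP; rewrite eq_sym -EFinB eqe subr_eq0 => /eqP <-.
by [].
Qed.

Lemma continuous_min1 (k : R) : continuous (fun x : R => Num.min 1 (`|x| * k)).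
Proof.
move=> x; apply: (@continuous_min R R (fun=> 1) (fun x => `|x| * k)).
  exact: cvg_cst.
by apply: cvgM; [exact: norm_continuous|exact: cvg_cst].
Qed.

Lemma min1_le1 (k x : R) : 0 <= k -> `|Num.min 1 (`|x| * k)| <= 1.
Proof.
move=> k0; rewrite ger0_norm; first by rewrite ge_min lexx.
by rewrite le_min ler01/= mulr_ge0.
Qed.

(** The integrand is a continuous substitute for the indicator of a tail, so weak continuity in time
    applies to it when tightness is made uniform. *)
Lemma expect_min1_cvg0 P :
  expect P (fun x => Num.min 1 (`|x| * n.+1%:R^-1)) @[n --> \oo] --> 0.
Proof.
have [] := expect_cvg P (F := fun n x => Num.min 1 (`|x| * n.+1%:R^-1))
  (f := cst 0) (M := 1).
- move=> n; apply: bmeas_cont; first exact: continuous_min1.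
  by exists 1 => x; exact: min1_le1.
- by move=> n x; exact: min1_le1.
- move=> x; have h : `|x| * n.+1%:R^-1 @[n --> \oo] --> `|x| * 0.
    by apply: cvgM; [exact: cvg_cst|exact: cvg_harmonic].
  rewrite mulr0 in h.
  apply: cvg_trans h; apply: near_eq_cvg; near=> n.
  rewrite min_r// ler_pdivrMr// mul1r.
  have : `|x| <= n%:R by near: n; exact: nbhs_infty_ger.
  by move=> /le_trans; apply; rewrite ler_nat.
- by rewrite expect_cst.
Unshelve. all: by end_near. Qed.

End CharacteristicFunction.

(** * The characteristic exponent near frequency 0 *)

Section Exponent.
Variables (R : realType) (muL : probability R R) (mus : R -> probability R R).
Hypothesis musL : levy_semigroup muL mus.

Lemma mus_cvg (f : R -> R) (s : R) (v : nat -> R) : continuous f -> (exists K, forall x, `|f x| <= K) ->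
  0 <= s -> (forall n, 0 <= v n) -> v n @[n --> \oo] --> s ->
  expect (mus (v n)) f @[n --> \oo] --> expect (mus s) f.
Proof. by move=> cf bf s0 v0 vs; have [_ _ _ h] := musL; have /weak_cvgP := h s v s0 v0 vs; exact. Qed.

Lemma rotation_semigroup_char u :
  rotation_semigroup (fun s => charc (mus s) u) (fun s => chars (mus s) u).
Proof.
have [h0 h1 hD _] := musL; split.
- by rewrite /charc (meq_expect _ h0) expect_dirac ?mulr0 ?cos0//; exact: bmeas_cos.
- by rewrite /chars (meq_expect _ h0) expect_dirac ?mulr0 ?sin0//; exact: bmeas_sin.
- by move=> s t s0 t0; exact/charc_conv/hD.
- by move=> s t s0 t0; exact/chars_conv/hD.
- move=> s v s0 v0 vs; apply: mus_cvg => //; first exact: continuous_cosu.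
  by exists 1 => x; exact: cos_max.
- move=> s v s0 v0 vs; apply: mus_cvg => //; first exact: continuous_sinu.
  by exists 1 => x; exact: sin_max.
Qed.

(* Compactness of [0, 1] gives uniform tightness of the laws [mus s]. *)
Lemma charc_pos_near0 : exists2 u1, 0 < u1 &
  forall u s, `|u| <= u1 -> 0 <= s <= 1 -> 0 < charc (mus s) u.
Proof.
pose F (n : nat) (x : R) : R := Num.min 1 (`|x| * n.+1%:R^-1).
have bF n : bmeas (F n).
  apply: bmeas_cont; first exact: continuous_min1.
  by exists 1 => x; exact: min1_le1.
have cF n : continuous (fun s => expect (forward mus s) (F n)).
  apply: (continuous_expect_forward musL); first exact: continuous_min1.
  by exists 1 => x; exact: min1_le1.
have Fmono n m s : (n <= m)%N -> expect (forward mus s) (F m) <= expect (forward mus s) (F n).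
  move=> nm; apply: le_expect => // x; rewrite /F le_min ge_min lexx/= ge_min.
  by apply/orP; right; rewrite ler_wpM2l// lef_pV2 ?posrE// ler_nat.
(* Dini's argument: the expectation of [F n] decreases in [n], so a bound reached at [N] persists,
   and continuity in [s] spreads it to a neighbourhood. *)
have /compact_near_coveringP h : compact (`[0, 1]%classic : set R) by exact: segment_compact.
have [//|N _ hN] := h nat \oo (fun n s => expect (forward mus s) (F n) < 4^-1) _ _.
  move=> s _.
  have [N _ hN] : \forall n \near \oo, expect (forward mus s) (F n) < 4^-1.
    apply: (cvgr_lt 0 (@expect_min1_cvg0 R (forward mus s))).
    by rewrite invr_gt0.
  have : \forall s' \near s, expect (forward mus s') (F N) < 4^-1.
    apply: (cvgr_lt (expect (forward mus s) (F N)) (cF N s)).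
    by apply: hN => /=.
  move=> hs; exists ([set s' | expect (forward mus s') (F N) < 4^-1], [set n | (N <= n)%N]) => /=.
    by split=> //; exists N.
  by move=> [s' n] /= [h1 h2]; apply: le_lt_trans h1; exact: Fmono.
(* For such [u], 1 - cos (u x) is at most [2 * F N x], whose expectation is below 1/2 by the choice
   of 1/4 above. *)
exists N.+1%:R^-1 => [//|u s uN s01].
have s0 : 0 <= s by case/andP: s01.
have : expect (mus s) (F N) < 4^-1.
  by rewrite -(forwardE _ s0); apply: hN => //=; rewrite ?in_itv.
have : expect (mus s) (fun x => 1 - cos (u * x)) <= expect (mus s) (fun x => 2 * F N x).
  apply: le_expect; [|exact: bmeasZ|].
    by apply: bmeasB; [exact: bmeas_cst|exact: bmeas_cos].
  move=> x; rewrite /F.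
  have h1 := oneBcos_le (u * x); have h2 := cos_geN1 (u * x).
  have h3 : `|u * x| <= `|x| * N.+1%:R^-1 by rewrite normrM mulrC ler_wpM2l.
  have h4 := normr_ge0 (u * x).
  move: h3; move: (`|x| * N.+1%:R^-1) => z h3; have [z1|z1] := leP 1 z; lra.
rewrite expectB ?expectZ ?expect_cst//; [|exact: bmeas_cst|exact: bmeas_cos].
by rewrite -/(charc (mus s) u); lra.
Qed.

Lemma levy_exponent : exists (u1 : R) (a b : R -> R), [/\ 0 < u1, a 0 = 0, b 0 = 0,
  forall u, `|u| <= u1 -> [/\ {for u, continuous a}, {for u, continuous b} & 0 <= a u] &
  forall u s, `|u| <= u1 -> 0 <= s ->
    charc (mus s) u = expR (- (s * a u)) * cos (s * b u) /\
    chars (mus s) u = expR (- (s * a u)) * sin (s * b u)].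
Proof.
have [u1 u1_0 pos] := charc_pos_near0.
pose c u := charc (mus 1) u; pose d u := chars (mus 1) u.
have cpos u : `|u| <= u1 -> 0 < c u by move=> hu; apply: pos => //; rewrite ler01 lexx.
(* Minus the real part, and the imaginary part, of the principal logarithm of c + i d, the
   characteristic function at time 1; for small [u] its real part is positive. *)
exists u1, (fun u => - (ln (c u ^+ 2 + d u ^+ 2) / 2)), (fun u => atan (d u / c u)).
have n0 u : `|u| <= u1 -> 0 < c u ^+ 2 + d u ^+ 2.
  by move=> hu; apply: ltr_pwDl; [exact/exprn_gt0/cpos|exact: sqr_ge0].
split=> //.
- by rewrite /c /d charc0 chars0 expr1n expr0n/= addr0 ln1 mul0r oppr0.
- by rewrite /d chars0 mul0r atan0.
- move=> u hu.
  have cc : {for u, continuous c} by exact: continuous_charc.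
  have cd : {for u, continuous d} by exact: continuous_chars.
  split.
  + apply: cvgN; apply: cvgM; last exact: cvg_cst.
    apply: continuous_comp; last by apply: continuous_ln; exact: n0.
    apply: cvgD; rewrite !expr2; exact: cvgM.
  + apply: continuous_comp; last exact: continuous_atan.
    by apply: cvgM => //; apply: cvgV => //; rewrite gt_eqF// cpos.
  + rewrite oppr_ge0 pmulr_lle0 ?invr_gt0//; apply: ln_le0; exact: char_norm_le1.
- move=> u s hu s0.
  have [h1 h2] := polar_form (d u) (cpos _ hu).
  apply: (rotation_semigroup_uniq (rotation_semigroup_char u)
    (rotation_semigroup_exp _ _)) => //.
  + by rewrite !mul1r opprK h1.
  + by rewrite !mul1r opprK h2.
  + by move=> t t01; exact: pos.
  (* For [t <= 1] the angle is at most the [atan] in absolute value, hence stays strictly within pi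
     / 2. *)
  + move=> t /andP[t0 t1]; apply: mulr_gt0; first exact: expR_gt0.
    apply: cos_gt0_pihalf; rewrite -ltr_norml normrM ger0_norm//.
    apply: le_lt_trans (_ : `|atan (d u / c u)| < _); first by rewrite ler_piMl.
    by rewrite ltr_norml atan_gtNpi2 atan_ltpi2.
Qed.

End Exponent.

(** * A semigroup of unimodular characteristic functions is a pure drift *)

Section Degenerate.
Variables (R : realType) (muL : probability R R) (mus : R -> probability R R).
Hypothesis musL : levy_semigroup muL mus.
Variables (u1 : R) (a b : R -> R).
Hypothesis u1_gt0 : 0 < u1.
Hypothesis b0 : b 0 = 0.
Hypothesis cb : forall u, `|u| <= u1 -> {for u, continuous b}.
Hypothesis char_exp : forall u s, `|u| <= u1 -> 0 <= s ->
  charc (mus s) u = expR (- (s * a u)) * cos (s * b u) /\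
  chars (mus s) u = expR (- (s * a u)) * sin (s * b u).

(* The characters at frequencies [u1 / n] tending to 0 separate points. *)
Lemma mus_drift s0 : 0 < s0 ->
  (forall u, 0 <= u <= u1 -> expR (- (s0 * a u)) = 1) ->
  exists g : R, forall s, 0 <= s -> meq (mus s) (\d_(s * g))%R.
Proof.
move=> s0_gt0 a0.
have {}a0 u : 0 <= u <= u1 -> a u = 0.
  move=> /a0; rewrite -[RHS]expR0 => /expR_inj/eqP.
  by rewrite oppr_eq0 mulf_eq0 gt_eqF//= => /eqP.
pose v n := u1 * n.+1%:R^-1.
have v_ge0 n : 0 <= v n by rewrite mulr_ge0// ltW.
have v_le n : v n <= u1 by rewrite ler_piMr ?(ltW u1_gt0)// invf_le1// ler1n.
have v_norm n : `|v n| <= u1 by rewrite ger0_norm.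
have v_gt0 n : 0 < v n by rewrite mulr_gt0.
have v_cvg : v n @[n --> \oo] --> 0.
  rewrite -[X in _ --> X](mulr0 u1); apply: cvgM; first exact: cvg_cst.
  exact: cvg_harmonic.
(* As [a] vanishes at [v n], this cosine has mean 1; being at most 1, it equals 1 almost surely. *)
have aeH s : 0 <= s -> {ae mus s, forall x, forall n, cos (v n * x - s * b (v n)) = 1}.
  move=> s_ge0; apply: ae_foralln => n; apply: expect1_ae.
  - apply: bmeas_cont; last by exists 1 => x; exact: cos_max.
    move=> x; apply: continuous_comp; last exact: continuous_cos.
    by apply: cvgB; [exact: continuous_mulu|exact: cvg_cst].
  - by move=> x; exact: cos_le1.
  have [h1 h2] := char_exp (v_norm n) s_ge0.
  have e0 : a (v n) = 0 by apply: a0; rewrite v_ge0 v_le.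
  rewrite e0 mulr0 oppr0 expR0 !mul1r in h1 h2.
  have -> : (fun x => cos (v n * x - s * b (v n))) =
    (fun x => cos (s * b (v n)) * cos (v n * x) + sin (s * b (v n)) * sin (v n * x)).
    by apply/funext => x; rewrite cosB; ring.
  rewrite expectD; [|exact/bmeasZ/bmeas_cos|exact/bmeasZ/bmeas_sin].
  rewrite !expectZ; [|exact: bmeas_sin|exact: bmeas_cos].
  by rewrite -/(charc _ _) -/(chars _ _) h1 h2 -!expr2 cos2Dsin2.
have [g hg] := probability_ae (aeH 1 ler01); exists g.
have bv_cvg : b (v n) @[n --> \oo] --> 0.
  rewrite -b0; apply: continuous_cvg => //; apply: cb.
  by rewrite normr0 ltW.
(* The difference is a multiple of 2 pi by the choice of [g], and it tends to 0, so it is eventually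
   0. The same argument then identifies almost every [x] at time [s] with [s * g]. *)
have bE : \forall n \near \oo, v n * g = b (v n).
  have h : v n * g - b (v n) @[n --> \oo] --> 0.
    rewrite -[X in _ --> X](subrr 0) -[X in X - _](mul0r g).
    by apply: cvgB => //; apply: cvgM => //; exact: cvg_cst.
  near=> n; apply/eqP; rewrite -subr_eq0; apply/eqP; apply: cos_eq1_small.
    rewrite -normrN -[X in `|X|]sub0r; near: n.
    by move/cvgrPdist_lt: h; apply; exact: pi_gt0.
  by have := hg n; rewrite mul1r.
move=> s s_ge0; apply: meq_dirac; apply: filterS (aeH s s_ge0) => x hx.
have h : v n * (x - s * g) @[n --> \oo] --> 0.
  by rewrite -[X in _ --> X](mul0r (x - s * g)); apply: cvgM => //; exact: cvg_cst.
near \oo => n.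
have : v n * (x - s * g) = 0.
  apply: cos_eq1_small.
    rewrite -normrN -[X in `|X|]sub0r; near: n.
    by move/cvgrPdist_lt: h; apply; exact: pi_gt0.
  have <- := hx n; congr cos.
  have <- : v n * g = b (v n) by near: n.
  by ring.
by move/eqP; rewrite mulf_eq0 gt_eqF//= subr_eq0 => /eqP.
Unshelve. all: by end_near. Qed.

End Degenerate.

(** * Strict running maxima of a continuous function *)

Section Records.
Variables (R : realType) (a : R -> R) (u1 : R).
Hypothesis a0 : a 0 = 0.
Hypothesis ca : forall u, 0 <= u <= u1 -> {for u, continuous a}.

(** Strictness makes [a] differ at [u] and at earlier points, so that difference quotients have
    nonzero denominators; [0 < a u] provides the decay that dominates them. *)
Definition record u :=
  [/\ 0 < u, u <= u1, 0 < a u & forall w, 0 <= w -> w < u -> a w < a u].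

Lemma record_exists u : 0 <= u <= u1 -> 0 < a u -> exists v, record v.
Proof.
move=> /andP[u0 uu1] au.
have hc y : 0 <= y <= u -> {for y, continuous a}.
  by move=> /andP[y0 yu]; apply: ca; rewrite y0 (le_trans yu).
have h0 : a 0 < a u by rewrite a0.
have [v [v0 vu av hv]] := first_hit u0 hc h0 (lexx _).
exists v; split => //; first exact: le_trans uu1.
  exact: lt_le_trans av.
by move=> w w0 wv; exact: lt_le_trans (hv _ w0 wv) av.
Qed.

(** Let [l] be a level below [a u] but above the maximum of [a] on [[0, y]], where [y] is [u - e] or
    0. The first point reaching [l] is a record between [u - e] and [u]. Taking [l] above [a u / 2]
    as well gives a decay rate common to all the records used. *)
Lemma record_accumulation u e : record u -> 0 < e ->
  exists v, [/\ record v, u - e < v, v < u & a u / 2 <= a v].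
Proof.
move=> [u0 uu1 au hu] e0.
pose y := Num.max 0 (u - e).
have y0 : 0 <= y by rewrite le_max lexx.
have yu : y < u by rewrite gt_max u0 ltrBlDr ltrDl.
have ca' : {within `[0, y], continuous a}.
  apply: continuous_in_subspaceT => z; rewrite inE/= in_itv/= => /andP[z0 zy].
  by apply: ca; rewrite z0 (le_trans zy)// (le_trans (ltW yu)).
have [c + hc] := EVT_max y0 ca'; rewrite in_itv/= => /andP[c0 cy].
pose l := (Num.max (a c) (a u / 2) + a u) / 2.
have Mu : Num.max (a c) (a u / 2) < a u.
  by rewrite gt_max hu//= ?(le_lt_trans cy)//; lra.
have lu : l < a u by rewrite /l; lra.
have Ml : Num.max (a c) (a u / 2) < l by rewrite /l; lra.
have acl : a c < l by apply: le_lt_trans Ml; rewrite le_max lexx.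
have al : a u / 2 < l by apply: le_lt_trans Ml; rewrite le_max lexx orbT.
have [x [x0 xu lx]] : exists x, [/\ 0 <= x, x < u & l <= a x].
  have : \forall z \near u, l < a z.
    have cau : a z @[z --> u] --> a u by apply: ca; rewrite ltW.
    exact: (cvgr_gt (a u) cau).
  move=> /nbhs_ballP[d /= d0 hd].
  exists (Num.max (u / 2) (u - d / 2)).
  have h1 : Num.max (u / 2) (u - d / 2) < u.
    by rewrite gt_max; apply/andP; split; lra.
  have h2 : u - d / 2 <= Num.max (u / 2) (u - d / 2) by rewrite le_max lexx orbT.
  split => //; first by rewrite le_max; apply/orP; left; lra.
  apply/ltW/hd; rewrite /ball/= gtr0_norm ?subr_gt0//; lra.
have hx z : 0 <= z <= x -> {for z, continuous a}.
  move=> /andP[z0 zx]; apply: ca; rewrite z0 (le_trans zx)//.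
  by rewrite (le_trans (ltW xu)).
have h0 : a 0 < l by rewrite a0; lra.
have [v [v0 vx av hv]] := first_hit x0 hx h0 lx.
have vu : v < u := le_lt_trans vx xu.
exists v; split => //.
- split => //; first exact: le_trans (ltW vu) uu1.
    by lra.
  by move=> w w0 wv; exact: lt_le_trans (hv _ w0 wv) av.
- rewrite ltNge; apply/negP => vue.
  have : a v <= a c.
    by apply: hc; rewrite in_itv/= (ltW v0)/= le_max vue orbT.
  by lra.
- by lra.
Qed.

Lemma record_sequence u : record u -> exists v : nat -> R,
  (forall n, [/\ record (v n), v n < u & a u / 2 <= a (v n)]) /\
  v n @[n --> \oo] --> u.
Proof.
move=> ru.
have h n : exists v, [/\ record v, u - n.+1%:R^-1 < v, v < u & a u / 2 <= a v].
  by apply: record_accumulation.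
exists (fun n => projT1 (cid (h n))); split.
  by move=> n; case: (cid (h n)) => v [].
apply: (@squeeze_cvgr _ _ _ _ (fun n => u - n.+1%:R^-1) (fun=> u)).
- by apply: nearW => n; case: (cid (h n)) => v /= [_ /ltW -> /ltW ->].
- rewrite -[X in _ --> X]subr0; apply: cvgB; [exact: cvg_cst|exact: cvg_harmonic].
- exact: cvg_cst.
Qed.

End Records.

(** * Test functions with equal expectations under two laws *)

Section SameExpectation.
Variables (R : realType) (mu1 mu2 : probability R R).

(** A linear space closed under bounded pointwise limits; uniqueness is proved by enlarging it from
    damped waves to indicators of half-lines. *)
Definition same (f : R -> R) := bmeas f /\ expect mu1 f = expect mu2 f.

Lemma same_cst (c : R) : same (cst c).
Proof. by split; [exact: bmeas_cst|rewrite !expect_cst]. Qed.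

Lemma sameD f g : same f -> same g -> same (fun x => f x + g x).
Proof. by move=> [bf ef] [bg eg]; split; [exact: bmeasD|rewrite !expectD// ef eg]. Qed.

Lemma sameB f g : same f -> same g -> same (fun x => f x - g x).
Proof. by move=> [bf ef] [bg eg]; split; [exact: bmeasB|rewrite !expectB// ef eg]. Qed.

Lemma sameZ (c : R) f : same f -> same (fun x => c * f x).
Proof. by move=> [bf ef]; split; [exact: bmeasZ|rewrite !expectZ// ef]. Qed.

Lemma same_sum (F : nat -> R -> R) n : (forall i, same (F i)) ->
  same (fun x => \sum_(i < n) F i x).
Proof.
move=> hF; split; first by apply: bmeas_sum => i; case: (hF i).
rewrite !expect_sum; [|by move=> i; case: (hF i)..].
by apply: eq_bigr => i _; case: (hF i).
Qed.

Lemma same_lim (F : nat -> R -> R) f M :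
  (forall n, same (F n)) -> (forall n x, `|F n x| <= M) ->
  (forall x, F n x @[n --> \oo] --> f x) -> same f.
Proof.
move=> hF FM Ff.
have bF n : bmeas (F n) by case: (hF n).
have [bf e1] := expect_cvg mu1 bF FM Ff.
have [_ e2] := expect_cvg mu2 bF FM Ff.
split=> //; rewrite -(cvg_lim _ e1)// -(cvg_lim _ e2)//.
suff -> : (fun n => expect mu1 (F n)) = (fun n => expect mu2 (F n)) by [].
by apply/funext => n; case: (hF n).
Qed.

Lemma same_meq : (forall t : R, same (\1_(`]t, +oo[%classic))) -> meq mu1 mu2.
Proof.
move=> h A mA.
apply: (@measure_unique _ R _ (@RGenOInfty.G R) (fun n => `](- n%:R), +oo[%classic)) => //.
- exact: RGenOInfty.measurableE.
- move=> _ _ [x ->] [y ->]; exists (Num.max x y).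
  by apply/seteqP; split=> z /=; rewrite !in_itv/= !andbT gt_max => /andP.
- by move=> n; exists (- n%:R).
- apply/seteqP; split => // x _; exists (Num.truncn `|x|).+1 => //=.
  rewrite in_itv/= andbT ltrNl.
  apply: le_lt_trans (_ : - x <= `|x|) _; first by rewrite -normrN ler_norm.
  by have /truncn_itv/andP[] := normr_ge0 x.
- move=> _ [x ->]; have [_ e] := h x.
  have mx : measurable (`]x, +oo[%classic : set R) by exact: measurable_itv.
  exact: (eq_trans (esym (expect_indic mu1 mx))
    (eq_trans (congr1 EFin e) (expect_indic mu2 mx))).
- move=> n; apply: le_lt_trans (probability_le1 mu1 _) _; last exact: ltry.
  exact: measurable_itv.
Qed.

End SameExpectation.

(** * Bounds for difference quotients of damped waves *)

Section AnalyticBounds.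
Variable R : realType.
Implicit Types (x a b : R).

Lemma pow_expR_bound k a : 0 < a ->
  exists2 C, 0 <= C & forall x, 0 <= x -> x ^+ k * expR (- (x * a)) <= C.
Proof.
(* From y^k / k! <= exp y at y = x a. *)
move=> a0; exists (k`!%:R / a ^+ k).
  by rewrite divr_ge0// exprn_ge0// ltW.
move=> x x0; have y0 : 0 <= x * a by rewrite mulr_ge0// ltW.
rewrite expRN ler_pdivrMr ?expR_gt0// mulrAC ler_pdivlMr ?exprn_gt0// -exprMn.
case: k => [|k]; first by rewrite expr0 fact0 mul1r -expR0 ler_expR.
rewrite [leRHS]mulrC -ler_pdivrMr ?ltr0n ?fact_gt0//.
by apply: le_trans (expR_ge1Dxn k y0); rewrite lerDr.
Qed.

Lemma expR_lip x y : x <= 0 -> y <= 0 -> `|expR y - expR x| <= `|y - x|.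
Proof.
wlog xy : x y / x <= y => [hw x0 y0|x0 y0].
  by have [|/ltW] := leP x y => h; [exact: hw|rewrite distrC (distrC y); exact: hw].
rewrite !ger0_norm ?subr_ge0 ?ler_expR//.
have h := expR_ge1Dx (x - y); have e : expR x = expR y * expR (x - y) by rewrite -expRD addrC subrK.
have e1 : expR y <= 1 by rewrite expR_le1.
have e0 := expR_gt0 y.
rewrite e -[X in X - _]mulr1 -mulrBr.
apply: (@le_trans _ _ (1 * (y - x))); last by rewrite mul1r.
apply: ler_pM => //.
  by rewrite subr_ge0 expR_le1 subr_le0.
by lra.
Qed.

Lemma cos_lip x y : `|cos y - cos x| <= `|y - x|.
Proof.
have [c [_ ->]] := cos_mvt x y; rewrite normrM ler_piMl// normrN; exact: sin_max.
Qed.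

Lemma sin_lip x y : `|sin y - sin x| <= `|y - x|.
Proof.
have [c [_ ->]] := sin_mvt x y; rewrite normrM ler_piMl//; exact: cos_max.
Qed.

Lemma norm_mul_le (t z M : R) : `|t| <= 1 -> `|z| <= M -> `|t * z| <= M.
Proof.
move=> t1 zM; rewrite normrM; apply: le_trans zM.
by rewrite ler_piMl.
Qed.

Lemma norm_prod_sub (q e c c' : R) : `|c'| <= 1 -> 0 <= e <= 1 ->
  `|q * c' - e * c| <= `|q - e| + `|c' - c|.
Proof.
move=> c1 /andP[e0 e1].
have -> : q * c' - e * c = c' * (q - e) + e * (c' - c) by ring.
apply: le_trans (ler_normD _ _) _; apply: lerD; first exact: norm_mul_le.
by apply: norm_mul_le => //; rewrite ger0_norm.
Qed.

(* The real part of the difference quotient of [w |-> exp (- x w + i phi)] between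
   [w = a - i b] and [w' = a' - i b'], compared with the derivative. *)
Lemma quotient_bound x a a' b b' phi : 0 <= x -> 0 < a -> a / 2 <= a' ->
  0 < (a' - a) ^+ 2 + (b' - b) ^+ 2 ->
  let C (r t : R) := expR (- (x * r)) * cos (x * t + phi) in
  let D (r t : R) := expR (- (x * r)) * sin (x * t + phi) in
  let Q := ((a' - a) * (C a' b' - C a b) - (b' - b) * (D a' b' - D a b)) /
           ((a' - a) ^+ 2 + (b' - b) ^+ 2) in
  `|Q + x * C a b| <= x * (x * (4 * (`|a' - a| + `|b' - b|))) /\
  `|Q| <= 4 * (x * expR (- (x * (a / 2)))).
Proof.
move=> x0 a0 aa' rho0 C D Q.
set al := a' - a; set be := b' - b.
rewrite -/al -/be in rho0; set rho := al ^+ 2 + be ^+ 2 in rho0.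
have a'0 : 0 < a' by lra.
have xa : 0 <= x * a by rewrite mulr_ge0// ltW.
have xa' : 0 <= x * a' by rewrite mulr_ge0// ltW.
have [z1 [z1m hz1 e1]] := expR_mvt (- (x * a)) (- (x * a')).
have [z2 [hz2 e2]] := cos_mvt (x * b + phi) (x * b' + phi).
have [z3 [hz3 e3]] := sin_mvt (x * b + phi) (x * b' + phi).
have {}z1m : z1 <= - (x * (a / 2)).
  apply: le_trans z1m _; rewrite ge_max !lerN2 !ler_wpM2l//; lra.
have dxa : - (x * a') - - (x * a) = - (x * al) by rewrite /al; ring.
have dxb : x * b' + phi - (x * b + phi) = x * be by rewrite /be; ring.
rewrite dxa in e1 hz1; rewrite dxb in e2 hz2 e3 hz3.
have S_s' : `|sin (x * b' + phi) - sin z2| <= 2 * (x * `|be|).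
  apply: le_trans (sin_lip _ _) _.
  have -> : x * b' + phi - z2 = x * be - (z2 - (x * b + phi)) by rewrite -dxb; ring.
  by apply: le_trans (ler_normB _ _) _; move: hz2; rewrite normrM (ger0_norm x0); lra.
have c_c' := cos_lip (x * b + phi) (x * b' + phi).
rewrite dxb normrM (ger0_norm x0) in c_c'.
have K_c : `|cos z3 - cos (x * b + phi)| <= x * `|be|.
  by apply: le_trans (cos_lip _ _) _; apply: le_trans hz3 _; rewrite normrM (ger0_norm x0).
have q_E : `|expR z1 - expR (- (x * a))| <= x * `|al|.
  apply: le_trans (expR_lip _ _) _.
  - by rewrite oppr_le0.
  - by apply: le_trans z1m _; rewrite oppr_le0 mulr_ge0//; lra.
  - by apply: le_trans hz1 _; rewrite normrN normrM (ger0_norm x0).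
have qle : expR z1 <= expR (- (x * (a / 2))) by rewrite ler_expR.
have Ele : expR (- (x * a)) <= expR (- (x * (a / 2))).
  by rewrite ler_expR lerN2 ler_wpM2l//; lra.
have E1 : 0 <= expR (- (x * a)) <= 1 by rewrite expR_ge0 expR_le1 oppr_le0.
have hS := sin_max z2; have hK := cos_max z3.
have hc' := cos_max (x * b' + phi); have hs' := sin_max (x * b' + phi).
have q0 := expR_ge0 z1.
rewrite {}/Q {}/C {}/D -/al -/be -/rho.
set E := expR (- (x * a)) in e1 q_E Ele E1 *.
set E' := expR (- (x * a')) in e1 *.
set c := cos (x * b + phi) in e2 c_c' K_c *.
set c' := cos (x * b' + phi) in e2 c_c' hc' *.
set s := sin (x * b + phi) in e3 *.
set s' := sin (x * b' + phi) in e3 S_s' hs' *.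
set q := expR z1 in e1 qle q_E q0; set S := sin z2 in e2 S_s' hS.
set K := cos z3 in e3 K_c hK; set M := expR (- (x * (a / 2))) in qle Ele *.
set Q := (_ / rho).
have E'E : E' = E - q * (x * al) by move: e1; lra.
have c'E : c' = c - S * (x * be) by move: e2; lra.
have s'E : s' = s + K * (x * be) by move: e3; lra.
(* These weights stay bounded by 1 however small [rho] is, and [t1 + t3 = 1] makes the leading terms
   add up to [E * c]. *)
pose t1 := al ^+ 2 / rho; pose t2 := al * be / rho; pose t3 := be ^+ 2 / rho.
have rho_neq0 : rho != 0 by rewrite gt_eqF.
have t13 : t1 + t3 = 1 by rewrite /t1 /t3 -mulrDl divff.
have t1_1 : `|t1| <= 1.
  by rewrite /t1 normrM normfV (gtr0_norm rho0) ler_pdivrMr// mul1r ger0_norm ?sqr_ge0// lerDl sqr_ge0.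
have t3_1 : `|t3| <= 1.
  by rewrite /t3 normrM normfV (gtr0_norm rho0) ler_pdivrMr// mul1r ger0_norm ?sqr_ge0// lerDr sqr_ge0.
have t2_1 : `|t2| <= 1.
  rewrite /t2 normrM normfV (gtr0_norm rho0) ler_pdivrMr// mul1r normrM.
  have := sqr_ge0 (`|al| - `|be|); have := normr_ge0 al; have := normr_ge0 be.
  by rewrite /rho -[al ^+ 2]real_normK ?num_real// -[be ^+ 2]real_normK ?num_real//; nra.
have QE : Q = - (x * (t1 * (q * c') + t2 * (E * S - q * s') + t3 * (E * K))).
  rewrite /Q (_ : E' * c' - E * c = - (q * (x * al)) * c' - E * (S * (x * be))); last first.
    by rewrite E'E c'E; ring.
  rewrite (_ : E' * s' - E * s = - (q * (x * al)) * s' + E * (K * (x * be))); last first.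
    by rewrite E'E s'E; ring.
  by rewrite /t1 /t2 /t3; field.
split.
  have -> : Q + x * (E * c) = - (x * (t1 * (q * c' - E * c) +
      - t2 * (q * s' - E * S) + t3 * (E * (K - c)))).
    have -> : x * (E * c) = x * ((t1 + t3) * (E * c)) by rewrite t13 mul1r.
    by rewrite QE; ring.
  rewrite normrN normrM (ger0_norm x0) ler_wpM2l//.
  have b1 : `|t1 * (q * c' - E * c)| <= x * `|al| + x * `|be|.
    apply: norm_mul_le => //; apply: le_trans (norm_prod_sub _ _ hc' E1) _.
    exact: lerD.
  have b2 : `|- t2 * (q * s' - E * S)| <= x * `|al| + 2 * (x * `|be|).
    apply: norm_mul_le; first by rewrite normrN.
    by apply: le_trans (norm_prod_sub _ _ hs' E1) _; exact: lerD.
  have b3 : `|t3 * (E * (K - c))| <= x * `|be|.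
    apply: norm_mul_le => //; apply: norm_mul_le => //.
    by case/andP: E1 => ? ?; rewrite ger0_norm.
  apply: le_trans (ler_normD _ _) _.
  apply: le_trans (lerD (ler_normD _ _) (lexx _)) _.
  have := mulr_ge0 x0 (normr_ge0 al); have := mulr_ge0 x0 (normr_ge0 be).
  by move: b1 b2 b3; lra.
rewrite QE normrN normrM (ger0_norm x0) [leRHS]mulrCA ler_wpM2l//.
have b1 : `|t1 * (q * c')| <= M.
  by apply: norm_mul_le => //; rewrite mulrC; apply: norm_mul_le => //; rewrite ger0_norm.
have EM : `|E| <= M by case/andP: E1 => ? ?; rewrite ger0_norm.
have b2 : `|t2 * (E * S - q * s')| <= M + M.
  apply: norm_mul_le => //; apply: le_trans (ler_normB _ _) _; apply: lerD.
    by rewrite mulrC; exact: norm_mul_le.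
  by rewrite mulrC; apply: norm_mul_le => //; rewrite ger0_norm.
have b3 : `|t3 * (E * K)| <= M.
  by apply: norm_mul_le => //; rewrite mulrC; exact: norm_mul_le.
apply: le_trans (ler_normD _ _) _.
apply: le_trans (lerD (ler_normD _ _) (lexx _)) _.
by move: b1 b2 b3; lra.
Qed.

End AnalyticBounds.

(** * Power series with exponential majorants, and powers converging to an indicator *)

Section PowerSeries.
Variable R : realType.
Implicit Types (x r b : R) (c : nat -> R).

Lemma series_exp_coeff_le (y : R) N : 0 <= y -> series (exp_coeff y) N <= expR y.
Proof.
move=> y0; apply: nondecreasing_cvgn_le; last exact: is_cvg_series_exp_coeff.
apply/nondecreasing_seqP => n; rewrite seriesS/= lerDr; exact: exp_coeff_ge0.
Qed.

Lemma power_sum_le c r x N : 0 <= r -> 0 <= x ->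
  (forall j, `|c j| <= r ^+ j / j`!%:R) ->
  `|\sum_(j < N) c j * x ^+ j| <= expR (x * r).
Proof.
move=> r0 x0 hc; apply: le_trans (ler_norm_sum _ _ _) _.
apply: le_trans (series_exp_coeff_le N (mulr_ge0 x0 r0)).
rewrite /series/= big_mkord; apply: ler_sum => j _.
rewrite normrM (ger0_norm (exprn_ge0 _ x0)) /exp_coeff/= exprMn.
by rewrite mulrC -mulrA ler_wpM2l ?exprn_ge0.
Qed.

(** The coefficient bound, shared with the cosine and sine series, keeps every partial sum below exp
    (x r) by [power_sum_le]; this is the domination needed under the integral. *)
Lemma expRN_power_series r : 0 <= r -> exists c,
  (forall j, `|c j| <= r ^+ j / j`!%:R) /\
  (forall x, 0 <= x -> \sum_(j < N) c j * x ^+ j @[N --> \oo] --> expR (- (x * r))).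
Proof.
move=> r0; exists (fun j => (- r) ^+ j / j`!%:R); split.
  by move=> j; rewrite normrM normrX normrN normfV !ger0_norm.
move=> x x0.
have h : series (exp_coeff (- (x * r))) @ \oo --> expR (- (x * r)).
  exact: is_cvg_series_exp_coeff.
suff <- : series (exp_coeff (- (x * r))) =
    (fun N => \sum_(j < N) ((- r) ^+ j / j`!%:R) * x ^+ j) by exact: h.
apply/funext => N; rewrite /series/= big_mkord; apply: eq_bigr => j _.
by rewrite /exp_coeff/= -mulrN exprMn; ring.
Qed.

Lemma cos_power_series b : exists c,
  (forall j, `|c j| <= `|b| ^+ j / j`!%:R) /\
  (forall x, 0 <= x -> \sum_(j < N) c j * x ^+ j @[N --> \oo] --> cos (x * b)).
Proof.
exists (fun j => (~~ odd j)%:R * (-1) ^+ j./2 * b ^+ j / j`!%:R); split.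
  move=> j; rewrite !normrM normrX normrN1 expr1n mulr1 normfV (ger0_norm (ler0n _ j`!)).
  rewrite normrX -mulrA ler_piMl//.
  by case: (odd j); rewrite /= ?normr0 ?normr1.
move=> x x0.
have h : series (cos_coeff (x * b)) @ \oo --> cos (x * b).
  by rewrite cos.unlock; exact: is_cvg_series_cos_coeff.
suff <- : series (cos_coeff (x * b)) = (fun N => \sum_(j < N)
    ((~~ odd j)%:R * (-1) ^+ j./2 * b ^+ j / j`!%:R) * x ^+ j) by exact: h.
apply/funext => N; rewrite /series/= big_mkord; apply: eq_bigr => j _.
by rewrite /cos_coeff/= exprMn -exprnP; ring.
Qed.

Lemma sin_power_series b : exists c,
  (forall j, `|c j| <= `|b| ^+ j / j`!%:R) /\
  (forall x, 0 <= x -> \sum_(j < N) c j * x ^+ j @[N --> \oo] --> sin (x * b)).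
Proof.
exists (fun j => (odd j)%:R * (-1) ^+ j.-1./2 * b ^+ j / j`!%:R); split.
  move=> j; rewrite !normrM normrX normrN1 expr1n mulr1 normfV (ger0_norm (ler0n _ j`!)).
  rewrite normrX -mulrA ler_piMl//.
  by case: (odd j); rewrite /= ?normr0 ?normr1.
move=> x x0.
have h : series (sin_coeff (x * b)) @ \oo --> sin (x * b).
  by rewrite sin.unlock; exact: is_cvg_series_sin_coeff.
suff <- : series (sin_coeff (x * b)) = (fun N => \sum_(j < N)
    ((odd j)%:R * (-1) ^+ j.-1./2 * b ^+ j / j`!%:R) * x ^+ j) by exact: h.
apply/funext => N; rewrite /series/= big_mkord; apply: eq_bigr => j _.
by rewrite /sin_coeff/= exprMn; ring.
Qed.

Lemma natr_expr_cvg0 (z : R) : 0 <= z -> z < 1 -> n%:R * z ^+ n @[n --> \oo] --> 0.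
Proof.
rewrite le_eqVlt => /predU1P[<-|z0] z1.
  apply: cvg_near_cst; near=> n; rewrite expr0n gtn_eqF ?mulr0//.
  by near: n; exact: nbhs_infty_gt.
have a0 : 0 < - ln z by rewrite oppr_gt0; apply: ln_lt0; rewrite z0.
have zE n : z ^+ n = expR (- (n%:R * - ln z)).
  by rewrite -mulrN opprK expRM_natl lnK.
(* n^2 z^n is bounded, so n z^n is at most a constant over n + 1; the factor 2 comes from n + 1 <= 2
   n. *)
have [C C0 hC] := @pow_expR_bound R 2 _ a0.
apply: (@squeeze_cvgr _ _ _ _ (fun=> 0) (fun n => C * 2 * n.+1%:R^-1)).
- near=> n; rewrite zE mulr_ge0 ?expR_ge0//=.
  have n0 : (0 < n)%N by near: n; exact: nbhs_infty_gt.
  have := hC n%:R (ler0n _ n); set e := expR _ => h.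
  rewrite ler_pdivlMr//.
  apply: le_trans (_ : n%:R ^+ 2 * e * 2 <= _); last by rewrite ler_pM2r.
  have -> : n%:R * e * n.+1%:R = (n%:R * n.+1%:R) * e by ring.
  have -> : n%:R ^+ 2 * e * 2 = (n%:R * (2 * n%:R)) * e by ring.
  rewrite ler_wpM2r ?expR_ge0// ler_wpM2l// -natrM ler_nat.
  by rewrite mul2n -addnn -add1n leq_add2r.
- exact: cvg_cst.
- by rewrite -[X in _ --> X](mulr0 (C * 2)); apply: cvgM; [exact: cvg_cst|exact: cvg_harmonic].
Unshelve. all: by end_near. Qed.

Lemma bernoulli_sub (y : R) n : 0 <= y <= 1 -> 1 - n%:R * y <= (1 - y) ^+ n.
Proof.
move=> /andP[y0 y1]; elim: n => [|n IH]; first by rewrite mul0r subr0 expr0.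
rewrite exprS; apply: (@le_trans _ _ ((1 - y) * (1 - n%:R * y))).
  have := mulr_ge0 (ler0n R n) (sqr_ge0 y); rewrite -natr1 expr2; nra.
by rewrite ler_wpM2l// subr_ge0.
Qed.

Lemma bernoulli_add (y : R) n : 0 <= y -> 1 + n%:R * y <= (1 + y) ^+ n.
Proof.
move=> y0; elim: n => [|n IH]; first by rewrite mul0r addr0 expr0.
rewrite exprS; apply: (@le_trans _ _ ((1 + y) * (1 + n%:R * y))).
  have := mulr_ge0 (ler0n R n) (sqr_ge0 y); rewrite -natr1 expr2; nra.
by rewrite ler_wpM2l// addr_ge0.
Qed.

(* The factor [n] in the exponent settles the boundary case [k t = 1]. *)
Lemma indic_expr_cvg (k : nat) (t : R) : 0 <= t <= 1 ->
  (1 - t ^+ n) ^+ (n * k ^ n) @[n --> \oo] --> (((k%:R * t < 1)%R)%:R : R).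
Proof.
move=> /andP[t0 t1].
have tn n : 0 <= t ^+ n <= 1 by rewrite exprn_ge0//= exprn_ile1.
have kt n : (n * k ^ n)%:R * t ^+ n = n%:R * (k%:R * t) ^+ n.
  by rewrite natrM natrX -mulrA exprMn.
have le1 n N : (1 - t ^+ n) ^+ N <= 1.
  by have /andP[h0 h1] := tn n; rewrite exprn_ile1 ?subr_ge0// lerBlDr lerDl.
have ge0 n N : 0 <= (1 - t ^+ n) ^+ N.
  by have /andP[h0 h1] := tn n; rewrite exprn_ge0// subr_ge0.
have [kt1|kt1] := ltP (k%:R * t) 1.
  apply: (@squeeze_cvgr _ _ _ _ (fun n => 1 - n%:R * (k%:R * t) ^+ n) (fun=> 1)).
  - by apply: nearW => n; rewrite le1 andbT -kt; exact: bernoulli_sub.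
  - rewrite -[X in _ --> X](subr0 1); apply: cvgB; first exact: cvg_cst.
    by apply: natr_expr_cvg0 => //; rewrite mulr_ge0.
  - exact: cvg_cst.
(* As (1 - y)(1 + y) <= 1, the power is at most the inverse of (1 + t^n)^(n k^n), which by Bernoulli
   is at least 1 + n (k t)^n, hence at least n + 1. *)
apply: (@squeeze_cvgr _ _ _ _ (fun=> 0) (fun n => n.+1%:R^-1)).
- apply: nearW => n; rewrite ge0/= -[leRHS]mul1r ler_pdivlMr//.
  apply: le_trans (_ : (1 - t ^+ n) ^+ (n * k ^ n) * (1 + t ^+ n) ^+ (n * k ^ n) <= 1).
    rewrite ler_wpM2l//; apply: le_trans (bernoulli_add _ _); last by case/andP: (tn n).
    by rewrite kt -natr1 addrC lerD2l ler_peMr// exprn_ege1.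
  rewrite -exprMn -subr_sqr expr1n -exprM.
  by rewrite exprn_ile1 ?lerBlDr ?lerDl ?subr_ge0 ?exprn_ge0// exprn_ile1.
- exact: cvg_cst.
- exact: cvg_harmonic.
Qed.

End PowerSeries.

(** * From waves at one point to equality of the two laws *)

Section Uniqueness.
Variables (R : realType) (mu1 mu2 : probability R R).
Local Notation same := (same mu1 mu2).
Implicit Types (a b phi x s : R).

(** Test functions are composed with this truncation, which bounds decaying exponentials on the
    whole line and changes nothing for laws on the half-line. *)
Definition nneg s := Num.max s 0.

Lemma nneg_ge0 s : 0 <= nneg s. Proof. by rewrite le_max lexx orbT. Qed.

(** For w = a - i b this is, up to sign, the real part of exp (i phi) times the k-th derivative in w
    of exp (- s w). Varying [phi] recovers the imaginary part. *)
Definition wave k a b phi s :=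
  nneg s ^+ k * (expR (- (nneg s * a)) * cos (nneg s * b + phi)).

(** The difference quotients [F n] converge to the next derivative, dominated thanks to
    [a / 2 <= an n]; [an n < a] keeps [rho n] positive. The phase [phi - pi / 2] supplies the sines
    in the real part of a complex quotient. *)
Lemma same_wave_derivative k a b (an bn : nat -> R) : 0 < a ->
  (forall n, a / 2 <= an n) -> (forall n, an n < a) ->
  an n @[n --> \oo] --> a -> bn n @[n --> \oo] --> b ->
  (forall n phi, same (wave k (an n) (bn n) phi)) ->
  (forall phi, same (wave k a b phi)) ->
  forall phi, same (wave k.+1 a b phi).
Proof.
move=> a0 an_ge an_lt an_cvg bn_cvg Wn W phi.
pose al n := an n - a; pose be n := bn n - b.
pose rho n := al n ^+ 2 + be n ^+ 2.
have rho0 n : 0 < rho n.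
  apply: ltr_pwDl; last exact: sqr_ge0.
  by rewrite lt_neqAle sqr_ge0 andbT eq_sym sqrf_eq0 subr_eq0 lt_eqF.
pose F n s := (rho n)^-1 *
  (al n * (wave k (an n) (bn n) phi s - wave k a b phi s) -
   be n * (wave k (an n) (bn n) (phi - pi / 2) s - wave k a b (phi - pi / 2) s)).
have sF n : same (F n).
  apply: sameZ; apply: sameB; apply: sameZ; exact: sameB.
have FE n s : F n s = nneg s ^+ k * (((an n - a) *
     (expR (- (nneg s * an n)) * cos (nneg s * bn n + phi) -
      expR (- (nneg s * a)) * cos (nneg s * b + phi)) -
   (bn n - b) *
     (expR (- (nneg s * an n)) * sin (nneg s * bn n + phi) -
      expR (- (nneg s * a)) * sin (nneg s * b + phi))) /
   ((an n - a) ^+ 2 + (bn n - b) ^+ 2)).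
  rewrite /F /wave !addrA !cosBpihalf /rho /al /be.
  by set r := (_ + _)^-1; ring.
have [C C0 hC] := @pow_expR_bound R k.+1 (a / 2) (divr_gt0 a0 (ltr0n R 2)).
have bnd n s := quotient_bound (b := b) (b' := bn n) phi (nneg_ge0 s) a0 (an_ge n) (rho0 n).
suff : same (fun s => -1 * wave k.+1 a b phi s).
  by move=> /(sameZ (-1)); under eq_fun do rewrite mulrA mulrNN !mul1r.
apply: (same_lim (F := F) (M := 4 * C)) => // [n s|s].
  have [_ h] := bnd n s; have p0 := nneg_ge0 s.
  rewrite FE normrM (ger0_norm (exprn_ge0 _ p0)).
  apply: le_trans (ler_wpM2l (exprn_ge0 k p0) h) _.
  have := hC _ p0; rewrite exprSr => h'.
  rewrite mulrCA ler_wpM2l//; apply: le_trans h'.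
  by rewrite le_eqVlt; apply/orP; left; apply/eqP; ring.
apply/cvgrPdist_le => e e0.
(* The summand 1 makes [K] a valid divisor even where [nneg s] is 0. *)
pose K := nneg s ^+ k * (nneg s * (nneg s * 4)) + 1.
have K0 : 0 < K by rewrite ltr_wpDl// !mulr_ge0 ?exprn_ge0 ?nneg_ge0.
have eK : 0 < e / K / 2 by rewrite !divr_gt0.
have h1 : \forall n \near \oo, `|a - an n| <= e / K / 2 by move/cvgrPdist_le: an_cvg; apply.
have h2 : \forall n \near \oo, `|b - bn n| <= e / K / 2 by move/cvgrPdist_le: bn_cvg; apply.
near=> n.
have [h _] := bnd n s; have p0 := nneg_ge0 s.
rewrite /= in h; set X := (X in `|X| <= _) in h.
have -> : -1 * wave k.+1 a b phi s - F n s = - (nneg s ^+ k * X).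
  by rewrite FE /wave /X exprS; set r := (_ + _)^-1; ring.
rewrite normrN normrM (ger0_norm (exprn_ge0 _ p0)).
apply: le_trans (ler_wpM2l (exprn_ge0 k p0) h) _.
have ha : `|an n - a| <= e / K / 2 by rewrite distrC; near: n.
have hb : `|bn n - b| <= e / K / 2 by rewrite distrC; near: n.
have -> : nneg s ^+ k * (nneg s * (nneg s * (4 * (`|an n - a| + `|bn n - b|)))) =
   (K - 1) * (`|an n - a| + `|bn n - b|) by rewrite /K; ring.
have ab0 : 0 <= `|an n - a| + `|bn n - b| by rewrite addr_ge0.
apply: (@le_trans _ _ (K * (`|an n - a| + `|bn n - b|))).
  by rewrite ler_wpM2r// lerBlDr lerDl.
rewrite mulrC -ler_pdivlMr//; move: ha hb; set z := e / K; lra.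
Unshelve. all: by end_near. Qed.

(* A weight decaying like [exp (- a s)] may be multiplied by any power series
   growing at most like [exp (a s / 2)]. *)
Lemma same_power_series (w : R -> R) (c : nat -> R) (f : R -> R) a r C :
  0 < a -> 0 <= r -> r <= a / 2 ->
  (forall s, `|w s| <= C * expR (- (nneg s * a))) ->
  (forall j, `|c j| <= r ^+ j / j`!%:R) ->
  (forall x, 0 <= x -> \sum_(j < N) c j * x ^+ j @[N --> \oo] --> f x) ->
  (forall k, same (fun s => nneg s ^+ k * w s)) ->
  forall k, same (fun s => nneg s ^+ k * (w s * f (nneg s))).
Proof.
move=> a0 r0 ra wC hc hf hw k.
have a20 : 0 < a / 2 by rewrite divr_gt0.
have C0 : 0 <= C.
  have := wC 0; rewrite /nneg maxxx mul0r oppr0 expR0 mulr1; exact: le_trans.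
have [K K0 hK] := pow_expR_bound k a20.
pose F N s := nneg s ^+ k * (w s * \sum_(j < N) c j * nneg s ^+ j).
apply: (same_lim (F := F) (M := C * K)).
- move=> N.
  have -> : F N = (fun s => \sum_(j < N) c j * (nneg s ^+ (k + j) * w s)).
    apply/funext => s; rewrite /F !mulr_sumr; apply: eq_bigr => j _.
    by rewrite exprD; ring.
  exact: (same_sum N (fun j => sameZ (c j) (hw (k + j)%N))).
- move=> N s; have p0 := nneg_ge0 s.
  rewrite /F normrM (ger0_norm (exprn_ge0 _ p0)) normrM.
  have h1 : `|\sum_(j < N) c j * nneg s ^+ j| <= expR (nneg s * (a / 2)).
    apply: le_trans (power_sum_le N r0 p0 hc) _.
    by rewrite ler_expR ler_wpM2l.
  apply: le_trans (_ : nneg s ^+ k * (C * expR (- (nneg s * a)) * expR (nneg s * (a / 2))) <= _).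
    by rewrite ler_wpM2l ?exprn_ge0// ler_pM.
  rewrite -mulrA -expRD (_ : - (nneg s * a) + nneg s * (a / 2) = - (nneg s * (a / 2))); last by field.
  by rewrite mulrCA ler_wpM2l// hK.
- move=> s; apply: cvgM; first exact: cvg_cst.
  apply: cvgM; first exact: cvg_cst.
  exact: (hf _ (nneg_ge0 s)).
Qed.

(** Multiplication by exp (- r s) is permitted for [r <= a / 2], and remains so as the decay rate
    grows; finitely many equal steps of this size reach any [x >= a]. *)
Lemma same_wave_decay a b : 0 < a -> (forall k phi, same (wave k a b phi)) ->
  forall x, a <= x -> forall k phi, same (wave k x b phi).
Proof.
move=> a0 W x ax.
suff H r n : 0 <= r <= a / 2 -> forall k phi, same (wave k (a + n%:R * r) b phi).
  pose n := (Num.truncn ((x - a) / (a / 2))).+1.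
  have n0 : 0 < n%:R :> R by rewrite ltr0n.
  have a20 : 0 < a / 2 by rewrite divr_gt0.
  have xa : 0 <= (x - a) / (a / 2) by rewrite divr_ge0 ?subr_ge0// ltW.
  have /truncn_itv/andP[_ hn] := xa.
  have -> : x = a + n%:R * ((x - a) / n%:R) by rewrite mulrCA divff ?gt_eqF// mulr1 addrC subrK.
  apply: H; rewrite divr_ge0 ?subr_ge0 ?ler0n//=.
  by rewrite ler_pdivrMr// mulrC -ler_pdivrMr// ltW.
move=> /andP[r0 ra]; elim: n => [|n IH] k phi; first by rewrite mul0r addr0.
have an0 : 0 < a + n%:R * r by rewrite ltr_pwDl// mulr_ge0.
have [c [hc hf]] := expRN_power_series r0.
have := @same_power_series (wave 0 (a + n%:R * r) b phi) c (fun x => expR (- (x * r)))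
  (a + n%:R * r) r 1 an0 r0 _ _ hc hf _ k.
have -> : (fun s => nneg s ^+ k * (wave 0 (a + n%:R * r) b phi s * expR (- (nneg s * r)))) =
    wave k (a + n.+1%:R * r) b phi.
  apply/funext => s; rewrite /wave expr0 mul1r mulrAC -expRD; congr (_ * (expR _ * _)).
  by rewrite -natr1; ring.
apply.
- by apply: le_trans ra _; rewrite ler_pM2r// lerDl mulr_ge0.
- move=> s; rewrite /wave expr0 !mul1r normrM ger0_norm ?expR_ge0//.
  by rewrite ler_piMr ?expR_ge0// cos_max.
- move=> j; have := IH j phi.
  suff -> : wave j (a + n%:R * r) b phi =
    (fun s => nneg s ^+ j * wave 0 (a + n%:R * r) b phi s) by [].
  by apply/funext => s; rewrite /wave expr0 mul1r.
Qed.

(** Multiplying the waves of phases 0 and - pi / 2 by cos (b s) and sin (b s) and adding removes the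
    oscillation, as cos^2 + sin^2 = 1. The term [2 * |b|] in [A] makes [|b| <= x / 2], as these two
    series require. *)
Lemma same_exp a b : 0 < a -> (forall k phi, same (wave k a b phi)) ->
  exists2 A, 0 < A & forall x, A <= x -> same (fun s => expR (- (nneg s * x))).
Proof.
move=> a0 W; pose A := a + 2 * `|b|.
have A0 : 0 < A by rewrite ltr_pwDl// mulr_ge0.
have aA : a <= A by rewrite lerDl mulr_ge0.
exists A => // x Ax; have x0 : 0 < x by exact: lt_le_trans Ax.
have Wx := same_wave_decay a0 W (le_trans aA Ax).
have bx : `|b| <= x / 2 by rewrite ler_pdivlMr// mulrC (le_trans _ Ax)// lerDr ltW.
have step phi (f : R -> R) c : (forall j, `|c j| <= `|b| ^+ j / j`!%:R) ->
    (forall x, 0 <= x -> \sum_(j < N) c j * x ^+ j @[N --> \oo] --> f x) ->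
    same (fun s => wave 0 x b phi s * f (nneg s)).
  move=> hc hf.
  have := @same_power_series (wave 0 x b phi) c f x `|b| 1 x0 (normr_ge0 _) bx _ hc hf _ 0%N.
  under eq_fun do rewrite expr0 mul1r.
  apply.
  - move=> s; rewrite /wave expr0 !mul1r normrM ger0_norm ?expR_ge0//.
    by rewrite ler_piMr ?expR_ge0// cos_max.
  - move=> j; have := Wx j phi.
    suff -> : wave j x b phi = (fun s => nneg s ^+ j * wave 0 x b phi s) by [].
    by apply/funext => s; rewrite /wave expr0 mul1r.
have [c [hc hcf]] := cos_power_series b; have [d [hd hdf]] := sin_power_series b.
have := sameD (step 0 _ _ hc hcf) (step (- (pi / 2)) _ _ hd hdf).
suff -> : (fun s => expR (- (nneg s * x))) = (fun s => wave 0 x b 0 s * cos (nneg s * b) +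
    wave 0 x b (- (pi / 2)) s * sin (nneg s * b)) by [].
apply/funext => s; rewrite /wave expr0 !mul1r addr0 cosBpihalf.
by rewrite -!mulrA -mulrDr -!expr2 cos2Dsin2 mulr1.
Qed.

Lemma same_laplace A : 0 < A -> (forall x, A <= x -> same (fun s => expR (- (nneg s * x)))) ->
  forall t, 0 < t -> same (\1_(`]t, +oo[%classic)).
Proof.
move=> A0 hE t t0.
(* An integer with ln k > A t: the rate c = ln k / t then exceeds [A], and [k%:R * T s < 1] holds
   exactly for [s > t]. *)
pose k := (Num.truncn (expR (A * t))).+1.
have k0 : 0 < k%:R :> R by rewrite ltr0n.
have Ak : A * t < ln k%:R.
  have /truncn_itv/andP[_ h] := expR_ge0 (A * t).
  by rewrite -ltr_expR lnK.
pose c := ln k%:R / t.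
have Ac : A <= c by rewrite ler_pdivlMr// ltW.
have c0 : 0 < c by exact: lt_le_trans Ac.
pose T s := expR (- (nneg s * c)).
have T01 s : 0 <= T s <= 1.
  by rewrite expR_ge0 expR_le1 oppr_le0 mulr_ge0 ?nneg_ge0// ltW.
have sT j : same (fun s => T s ^+ j).
  case: j => [|j]; first by under eq_fun do rewrite expr0; exact: same_cst.
  have -> : (fun s => T s ^+ j.+1) = (fun s => expR (- (nneg s * (j.+1%:R * c)))).
    apply/funext => s; rewrite /T -expRM_natl; congr expR; ring.
  by apply: hE; apply: le_trans Ac _; rewrite ler_peMl ?(ltW c0)// ler1n.
(* The factor [T s ^+ j] lets the induction on [N] close, since one more factor 1 - T^n subtracts
   the same term with [j] raised by [n]. *)
have sP n N j : same (fun s => T s ^+ j * (1 - T s ^+ n) ^+ N).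
  elim: N j => [|N IH] j; first by under eq_fun do rewrite expr0 mulr1; exact: sT.
  have -> : (fun s => T s ^+ j * (1 - T s ^+ n) ^+ N.+1) =
     (fun s => T s ^+ j * (1 - T s ^+ n) ^+ N - T s ^+ (j + n) * (1 - T s ^+ n) ^+ N).
    by apply/funext => s; rewrite exprS exprD; ring.
  exact: sameB.
apply: (same_lim (F := fun n s => (1 - T s ^+ n) ^+ (n * k ^ n)) (M := 1)).
- move=> n; have := sP n (n * k ^ n)%N 0%N.
  by under eq_fun do rewrite expr0 mul1r.
- move=> n s; have /andP[h0 h1] := T01 s.
  have g0 : 0 <= 1 - T s ^+ n by rewrite subr_ge0 exprn_ile1.
  by rewrite ger0_norm ?exprn_ge0// exprn_ile1// lerBlDr lerDl exprn_ge0.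
- move=> s; have := indic_expr_cvg (k := k) (T01 s).
  suff -> : (k%:R * T s < 1) = (t < s) by rewrite indicE mem_setE in_itv/= andbT.
  have kE : k%:R = expR (t * c) by rewrite /c mulrCA divff ?gt_eqF// mulr1 lnK.
  rewrite kE /T -expRD expR_lt1 -mulrBl pmulr_llt0// subr_lt0.
  by rewrite /nneg lt_max (lt_gtF t0) orbF.
Qed.

Lemma same_laplace_meq A :
  mu1 [set x | 0 <= x] = 1%E -> mu2 [set x | 0 <= x] = 1%E ->
  0 < A -> (forall x, A <= x -> same (fun s => expR (- (nneg s * x)))) ->
  meq mu1 mu2.
Proof.
move=> p1 p2 A0 hE; have h := same_laplace A0 hE.
have itvm t : measurable (`]t, +oo[%classic : set R) by exact: measurable_itv.
apply: same_meq => t; have [|t0] := ltP 0 t; first exact: h.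
(* The half-line from 0 is the limit of those from 1 / (n + 1); a half-line from a negative point
   has mass 1 under both laws. *)
have [t00|tlt] := eqVneq t 0.
  subst t.
  apply: (same_lim (F := fun n => \1_(`]n.+1%:R^-1, +oo[%classic)) (M := 1)).
  - by move=> n; apply: h.
  - by move=> n x; rewrite indicE; case: (_ \in _); rewrite ?normr0 ?normr1.
  - move=> x; rewrite indicE mem_setE in_itv/= andbT; apply: cvg_near_cst.
    have [x0|x0] := ltP 0 x; near=> n; rewrite indicE mem_setE in_itv/= andbT.
      rewrite (_ : _ < x)//.
      by near: n; apply: (cvgr_lt 0 (@cvg_harmonic R)).
    by rewrite ltNge (le_trans x0)//= invr_ge0.
split; first exact: bmeas_indic.
have e (m : probability R R) : m [set x | 0 <= x] = 1%E -> expect m (\1_(`]t, +oo[%classic)) = 1.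
  move=> m1; have /eqP : (expect m (\1_(`]t, +oo[%classic)))%:E = 1%E.
    rewrite expect_indic//; apply: probability_sub1 m1 => //; first exact: measurable_nonneg.
    by move=> x /= x0; rewrite in_itv/= andbT; apply: lt_le_trans x0; rewrite lt_neqAle tlt.
  by rewrite eqe => /eqP.
by rewrite !e.
Unshelve. all: by end_near. Qed.

End Uniqueness.

(** * Pure drift, or injectivity by uniqueness of Laplace transforms *)

Section Injectivity.
Variables (R : realType) (muL : probability R R) (mus : R -> probability R R).
Hypothesis musL : levy_semigroup muL mus.
Hypothesis muL_neq0 : ~ meq muL (\d_(0 : R))%R.

Lemma mus_dichotomy :
  (exists2 g : R, g != 0 & forall s, 0 <= s -> meq (mus s) (\d_(s * g))%R) \/
  (forall mu1 mu2 nu : probability R R,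
    mu1 [set x | 0 <= x] = 1%E -> mu2 [set x | 0 <= x] = 1%E ->
    is_Lambda mus mu1 nu -> is_Lambda mus mu2 nu -> meq mu1 mu2).
Proof.
have [u1 [a [b [u1_0 a0 b0 hab hchar]]]] := levy_exponent musL.
have [apos|aneg] := pselect (exists u, 0 <= u <= u1 /\ 0 < a u); last first.
  left; have aE u : 0 <= u <= u1 -> a u = 0.
    move=> hu; apply/eqP; rewrite eq_le leNgt; apply/andP; split.
      by apply/negP => au; apply: aneg; exists u.
    by have [] := hab u; rewrite ?ger0_norm//; case/andP: hu.
  have [||g hg] := @mus_drift R mus u1 a b u1_0 b0 _ hchar 1 ltr01.
  - by move=> u /hab[].
  - by move=> u hu; rewrite aE// mulr0 oppr0 expR0.
  exists g => //; apply/eqP => g0; apply: muL_neq0.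
  have [_ h1 _ _] := musL; apply: meq_trans (meq_sym h1) _.
  by have := hg 1 ler01; rewrite g0 mulr0.
right=> mu1 mu2 nu p1 p2 L1 L2.
have ca u : 0 <= u <= u1 -> {for u, continuous a}.
  by move=> /andP[u0 uu1]; have [] := hab u; rewrite ?ger0_norm.
(* Both mixtures reproduce the characteristic function of [nu] at [u]; weighting its two parts by
   cos phi and sin phi gives every phase. *)
have base u phi : 0 <= u <= u1 -> 0 < a u -> same mu1 mu2 (wave 0 (a u) (b u) phi).
  move=> /andP[u0 uu1] au.
  have un : `|u| <= u1 by rewrite ger0_norm.
  have [_ c1] := expect_Lambda musL p1 L1 (bmeas_cos u).
  have [bc c2] := expect_Lambda musL p2 L2 (bmeas_cos u).
  have [_ s1] := expect_Lambda musL p1 L1 (bmeas_sin u).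
  have [bs s2] := expect_Lambda musL p2 L2 (bmeas_sin u).
  have sc : same mu1 mu2 (fun s => charc (forward mus s) u) by split=> //; rewrite -c1.
  have ss : same mu1 mu2 (fun s => chars (forward mus s) u) by split=> //; rewrite -s1.
  have := sameB (sameZ (cos phi) sc) (sameZ (sin phi) ss).
  suff -> : wave 0 (a u) (b u) phi = (fun s => cos phi * charc (forward mus s) u -
      sin phi * chars (forward mus s) u) by [].
  apply/funext => s; have [-> ->] := hchar u (nneg s) un (nneg_ge0 s).
  by rewrite /wave expr0 mul1r cosD; ring.
(* The induction treats all records at once: order [k.+1] at [u] uses order [k] at the records
   approaching [u]. *)
have all_k k : forall u, record a u1 u -> forall phi, same mu1 mu2 (wave k (a u) (b u) phi).
  elim: k => [|k IH] u ru phi.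
    by have [u0 uu1 au _] := ru; apply: base => //; rewrite ltW.
  have [v [hv vu]] := record_sequence a0 ca ru.
  have [u0 uu1 au hu] := ru.
  have un : `|u| <= u1 by rewrite ger0_norm// ltW.
  have [cau cbu _] := hab u un.
  apply: (@same_wave_derivative R mu1 mu2 k (a u) (b u) (a \o v) (b \o v)) => //.
  - by move=> n; have [] := hv n.
  - by move=> n; have [[v0 _ _ _] vlt _] := hv n; apply: hu => //; rewrite ltW.
  - exact: (continuous_cvg _ cau vu).
  - exact: (continuous_cvg _ cbu vu).
  - by move=> n phi'; apply: IH; have [] := hv n.
  - by move=> phi'; exact: IH.
have [u0 [hu0 au0]] := apos.
have [u ru] := record_exists a0 ca hu0 au0.
have [_ _ au _] := ru.
have [A A0 hA] := same_exp au (fun k phi => all_k k u ru phi).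
exact: same_laplace_meq p1 p2 A0 hA.
Qed.

End Injectivity.

(** * The drift case and Dirac masses in the image *)

Section Image.
Variables (R : realType) (muL : probability R R) (mus : R -> probability R R).
Hypothesis musL : levy_semigroup muL mus.
Hypothesis muL_neq0 : ~ meq muL (\d_(0 : R))%R.

Lemma Lambda_drift_inj (g : R) (mu1 mu2 nu : probability R R) : g != 0 ->
  (forall s, 0 <= s -> meq (mus s) (\d_(s * g))%R) ->
  mu1 [set x | 0 <= x] = 1%E -> mu2 [set x | 0 <= x] = 1%E ->
  is_Lambda mus mu1 nu -> is_Lambda mus mu2 nu -> meq mu1 mu2.
Proof.
move=> g0 hg.
suff h (mu : probability R R) : mu [set x | 0 <= x] = 1%E -> is_Lambda mus mu nu ->
    forall A, measurable A -> mu A = nu [set y | A (y / g)].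
  by move=> p1 p2 L1 L2 A mA; rewrite (h _ p1 L1)// (h _ p2 L2).
move=> p L A mA.
have mB : measurable [set y : R | A (y / g)].
  have m : measurable_fun setT (fun y : R => y / g) by exact: mulrr_measurable.
  by rewrite -[X in measurable X]setTI; exact: m.
rewrite L//.
rewrite (@eq_integral_full_measure R mu [set x | 0 <= x] _ (fun s => (\1_A s)%:E))//.
- by rewrite integral_indic// setIT.
- exact: measurable_nonneg.
- move=> s s0; rewrite hg//= diracE indicE; congr ((_ : bool)%:R%:E).
  apply/idP/idP; rewrite !inE/= mulfK//.
Qed.

Lemma convol_dirac (x y : R) (P Q : probability R R) :
  meq P (\d_x)%R -> meq Q (\d_y)%R -> meq (convol P Q) (\d_(x + y))%R.
Proof.
move=> hP hQ A mA; rewrite /convol (eq_measure_integral (\d_x)%R); last first.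
  by move=> B mB _; exact: hP.
rewrite integral_dirac//; last exact: (measurable_convol_section (Q : giry R R)).
rewrite diracT mul1e hQ ?diracE//; last exact: measurable_section.
Qed.

Lemma dirac_is_ID (x : R) : is_ID (\d_x : probability R R).
Proof.
move=> n n0; exists (\d_(x / n%:R) : probability R R).
suff h k : meq (\d_(k%:R * (x / n%:R)) : probability R R)%R (nconv (\d_(x / n%:R))%R k).
  have := h n; rewrite mulrCA divff ?mulr1//.
  by rewrite pnatr_eq0 -lt0n.
elim: k => [|k IH]; first by rewrite mul0r.
apply: meq_sym; apply: meq_trans (meq_convolr _ (meq_sym IH)) _.
rewrite -natr1 mulrDl mul1r addrC.
by apply: convol_dirac.
Qed.

(** A mixture giving mass 1 to a point has almost all its components concentrated there; any such
    component will do. *)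
Lemma Lambda_dirac (mu : probability R R) (x : R) : mu [set x | 0 <= x] = 1%E ->
  is_Lambda mus mu (\d_x : probability R R)%R ->
  exists2 s, 0 <= s & meq (mus s) (\d_x)%R.
Proof.
move=> p L.
have bx : bmeas (\1_[set x] : R -> R) by apply: bmeas_indic; exact: measurable_set1.
have [bK e] := expect_Lambda musL p L bx.
rewrite expect_dirac// indicE mem_set//= in e.
have K1 s : expect (forward mus s) (\1_[set x]) <= 1.
  by rewrite -lee_fin expect_indic//; apply: probability_le1; exact: measurable_set1.
have [s hs] := probability_ae (expect1_ae bK K1 (esym e)).
exists (Num.max s 0); first by rewrite le_max lexx orbT.
have i1 y : \1_[set x] y <= 1 :> R by rewrite indicE; case: (_ \in _).
apply: meq_dirac; apply: filterS (expect1_ae bx i1 hs) => y.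
rewrite indicE; have [/set_mem//|_ /eqP] := boolP (y \in [set x]).
by rewrite eq_sym oner_eq0.
Qed.

Lemma no_opposite_diracs (s t : R) : 0 <= s -> 0 <= t ->
  meq (mus s) (\d_(1 : R))%R -> meq (mus t) (\d_(-1 : R))%R -> False.
Proof.
move=> s0 t0 hs ht.
have [h0 h1 hD _] := musL.
have hst : meq (mus (s + t)) (\d_(0 : R))%R.
  by apply: meq_trans (hD _ _ s0 t0) _; rewrite -(subrr 1); exact: convol_dirac.
(* If the sum were 0, so would be [s], and the Dirac masses at 0 and 1 would agree. *)
have st0 : 0 < s + t.
  rewrite lt_neqAle addr_ge0// andbT eq_sym paddr_eq0//.
  apply/negP => /andP[/eqP s00 _]; have := hs [set 0] (measurable_set1 _).
  rewrite s00 h0 ?diracE; last exact: measurable_set1.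
  rewrite mem_set// memNset; last by move=> /= /eqP; rewrite oner_eq0.
  by move/eqP; rewrite eqe oner_eq0.
have [u1 [a [b [u1_0 a0 b0 hab hchar]]]] := levy_exponent musL.
(* One positive time suffices: the characteristic function of the Dirac mass at 0 has modulus 1, so
   exp (- (s + t) a(u)) = 1 on [[0, u1]] and the whole semigroup is a drift, necessarily of speed
   0. *)
have [||g hg] := @mus_drift R mus u1 a b u1_0 b0 _ hchar (s + t) st0.
- by move=> u /hab[].
- move=> u /andP[u0 uu1]; have un : `|u| <= u1 by rewrite ger0_norm.
  have [c1 c2] := hchar u _ un (ltW st0).
  have e1 : expR (- ((s + t) * a u)) * cos ((s + t) * b u) = 1.
    rewrite -c1 /charc (meq_expect _ hst) expect_dirac ?mulr0 ?cos0//; exact: bmeas_cos.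
  have e2 : expR (- ((s + t) * a u)) * sin ((s + t) * b u) = 0.
    rewrite -c2 /chars (meq_expect _ hst) expect_dirac ?mulr0 ?sin0//; exact: bmeas_sin.
  apply/eqP; rewrite -(@eqrXn2 _ 2) ?expR_ge0// expr1n; apply/eqP.
  have -> : expR (- ((s + t) * a u)) ^+ 2 =
      (expR (- ((s + t) * a u)) * cos ((s + t) * b u)) ^+ 2 +
      (expR (- ((s + t) * a u)) * sin ((s + t) * b u)) ^+ 2.
    by rewrite !exprMn -mulrDr cos2Dsin2 mulr1.
  by rewrite e1 e2 expr1n expr0n/= addr0.
have g0 : g = 0.
  have := hg _ (ltW st0) [set 0] (measurable_set1 _).
  rewrite hst ?diracE; last exact: measurable_set1.
  rewrite mem_set//; have [/set_mem/= /eqP|_ /eqP] := boolP ((s + t) * g \in [set 0]).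
    by rewrite mulf_eq0 gt_eqF//= => /eqP.
  by rewrite eqe oner_eq0.
apply: muL_neq0; apply: meq_trans (meq_sym h1) _.
by have := hg 1 ler01; rewrite g0 mulr0.
Qed.

End Image.

Theorem theorem4p1 (R : realType) (muL : probability R R)
  (mus : R -> probability R R) :
  is_ID muL ->
  ~ meq muL (@dirac _ R 0%R R) ->
  levy_semigroup muL mus ->
  [/\ (* Lambda maps ID(R+) into ID(R) (well defined) *)
      (forall muT, is_IDplus muT ->
         exists nu : probability R R, is_Lambda mus muT nu /\ is_ID nu),
      (* injective *)
      (forall mu1 mu2 nu : probability R R, is_IDplus mu1 -> is_IDplus mu2 ->
         is_Lambda mus mu1 nu -> is_Lambda mus mu2 nu -> meq mu1 mu2),
      (* continuous for weak convergence *)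
      (forall (mun : nat -> probability R R) (mu : probability R R)
              (nun : nat -> probability R R) (nu : probability R R),
         (forall n, is_IDplus (mun n)) -> is_IDplus mu ->
         (forall n, is_Lambda mus (mun n) (nun n)) -> is_Lambda mus mu nu ->
         weak_cvg mun mu -> weak_cvg nun nu),
      (* convolution homomorphism *)
      (forall mu1 mu2 mu12 nu1 nu2 nu12 : probability R R,
         is_IDplus mu1 -> is_IDplus mu2 -> meq mu12 (convol mu1 mu2) ->
         is_Lambda mus mu1 nu1 -> is_Lambda mus mu2 nu2 ->
         is_Lambda mus mu12 nu12 ->
         meq nu12 (convol nu1 nu2)) &
      (* the image is a proper subset of ID(R) *)
      (exists nu : probability R R, is_ID nu /\
         forall muT, is_IDplus muT -> ~ is_Lambda mus muT nu)].
Proof.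
move=> _ muL0 musL; split.
- move=> muT ID; have [nu hnu] := Lambda_exists musL ID.2.
  by exists nu; split=> //; exact: (Lambda_ID musL ID hnu).
- move=> mu1 mu2 nu [_ p1] [_ p2] L1 L2.
  have [[g g0 hg]|inj] := mus_dichotomy musL muL0; last exact: inj p1 p2 L1 L2.
  exact: Lambda_drift_inj g0 hg p1 p2 L1 L2.
- move=> mun mu nun nu IDn [_ p] Ln L; apply: (Lambda_continuous musL) => //.
  by move=> n; have [] := IDn n.
- by move=> mu1 mu2 mu12 nu1 nu2 nu12 [_ p1] [_ p2]; exact: (Lambda_convol musL).
- have dirac_ID (x : R) : is_ID (\d_x : probability R R).
    exact: dirac_is_ID.
  have [h1|h1] := pselect (exists2 muT, is_IDplus muT & is_Lambda mus muT (\d_(1 : R))%R);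
    last first.
    by exists (\d_(1 : R))%R; split=> // muT IDT LT; apply: h1; exists muT.
  have [h2|h2] := pselect (exists2 muT, is_IDplus muT & is_Lambda mus muT (\d_(-1 : R))%R);
    last first.
    by exists (\d_(-1 : R))%R; split=> // muT IDT LT; apply: h2; exists muT.
  exfalso; have [mu1 [_ p1] /(Lambda_dirac musL p1) [s s0 hs]] := h1.
  have [mu2 [_ p2] /(Lambda_dirac musL p2) [t t0 ht]] := h2.
  exact: (no_opposite_diracs musL muL0 s0 t0 hs ht).
Qed.
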